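(* Let $f(z)$ be an algebraic function that is analytic in a neighborhood of $[1,\infty)$. Then the sequence $(f(n))_{n\ge1}$ is holonomic if and only if $f(z)$ is a rational function.
   Context: A sequence $(a_n)_{n\ge1}$ of complex numbers is holonomic if there exist polynomials $p_0,\dots,p_d\in\mathbb{C}[x]$, not all zero, such that $p_0(n)a_n+p_1(n)a_{n+1}+\dots+p_d(n)a_{n+d}=0$ for all integers $n\ge1$ (equivalently, for all $n\ge n_0$ for some $n_0$). *)

(* Defs.v *)
From HB Require Import structures.
From mathcomp Require Import all_boot all_order all_algebra.
From mathcomp Require Import all_classical all_reals all_analysis.
From mathcomp Require Import complex.

Set Implicit Arguments.
Unset Strict Implicit.
Unset Printing Implicit Defensive.

Import Order.TTheory GRing.Theory Num.Theory.
Import numFieldNormedType.Exports.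

Local Open Scope classical_set_scope.
Local Open Scope ring_scope.
Local Open Scope complex_scope.

(* The field of complex numbers is R[i] for a realType R.  It is written
   R[i]^o where the normed-space (hence topological) structure over itself is
   needed, so that [derivable f z 1] is complex differentiability. *)

Definition analytic_on (R : realType) (U : set R[i]^o)
    (f : R[i]^o -> R[i]^o) : Prop :=
  forall z : R[i]^o, U z -> derivable f z 1.

(* P is a polynomial in w whose coefficients are polynomials in z:
   P.[w%:P].[z] is the value P(z, w). *)
Definition algebraic_on (R : realType) (U : set R[i]^o)
    (f : R[i]^o -> R[i]^o) : Prop :=
  exists P : {poly {poly R[i]}},
    P != 0 /\ forall z : R[i]^o, U z -> P.[(f z)%:P].[z] = 0.

(* Division is total, with x / 0 = 0, so the absence of poles is stated. *)
Definition rational_on (R : realType) (U : set R[i]^o)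
    (f : R[i]^o -> R[i]^o) : Prop :=
  exists p q : {poly R[i]},
    q != 0 /\ forall z : R[i]^o, U z -> q.[z] != 0 /\ f z = p.[z] / q.[z].

(* The sequence is (a_n) for n >= 1; the value a 0 is never used. *)
Definition holonomic (R : realType) (a : nat -> R[i]) : Prop :=
  exists (d : nat) (p : 'I_d.+1 -> {poly R[i]}),
    (exists k, p k != 0) /\
    forall n : nat, (1 <= n)%N -> \sum_(k < d.+1) (p k).[n%:R] * a (n + k)%N = 0.

(* Main.v *)
(* Let [D] be the discriminant of a separable equation [P(z, f(z)) = 0] times its
   leading coefficient, and let [F_n] be the formal expansion of [f] at a large
   integer [n].  The series [h_n = sum_k p_k(n + t) F_(n+k)(t)] is algebraic, by an equation
   independent of [n], and vanishes at [t = 0], which forces [h_n = 0].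
   Eliminating repeatedly, a polynomial multiple [g] of [F_n] is a combination of
   [F_(n+j+1), ..., F_(n+j+d)] with [j] as large as we please.  The singularities
   of [F_n] are zeros of [D(n + t)], those of [F_(n+i)] are zeros of [D(n + i + t)],
   and for large [j] these are disjoint: [g] has no finite singularity.
   Algebraically, all derivatives of [g] lie in one finitely generated
   [C[t]]-module, so [g] solves a linear differential equation with polynomial
   coefficients and leading coefficient [1], hence its expansion converges
   everywhere; being integral over [C[t]] it has polynomial growth, so it is a
   polynomial.  Thus [F_n] is rational, and [f] coincides with it on [U] by
   connectedness. *)

Require Import Defs.
From HB Require Import structures.
From mathcomp Require Import all_boot all_order all_algebra.
From mathcomp Require Import cyclic separable cyclotomic.
From mathcomp Require Import all_classical all_reals all_analysis.
From mathcomp Require Import complex.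
From mathcomp Require Import ring zify.
Import Order.TTheory GRing.Theory Num.Theory.
Import numFieldNormedType.Exports.
Set Implicit Arguments.
Unset Strict Implicit.
Unset Printing Implicit Defensive.
Local Open Scope classical_set_scope.
Local Open Scope ring_scope.
Local Open Scope complex_scope.

(** * Formal power series *)

Definition fps (K : Type) := nat -> K.

Section PowerSeries.
Variable K : comNzRingType.
Implicit Types (u v w : fps K) (p q : {poly K}).

HB.instance Definition _ := GRing.Zmodule.copy (fps K) (nat -> K).

Definition fps_mul u v : fps K := fun n => \sum_(i < n.+1) u i * v (n - i)%N.

Definition fps_of_poly p : fps K := fun n => p`_n.

Definition fps_trunc n u : {poly K} := \poly_(i < n) u i.

Lemma fps_truncE n u i : (i < n)%N -> (fps_trunc n u)`_i = u i.
Proof. by rewrite coef_poly => ->. Qed.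

(** The coefficient of index [n] of a product involves only coefficients of index at most [n], so
    identities between series reduce to polynomial ones by truncation. Associativity, commutativity
    and the Leibniz rule are obtained in this way. *)
Lemma fps_mul_coefM u v p q n :
  (forall i, (i <= n)%N -> p`_i = u i) -> (forall i, (i <= n)%N -> q`_i = v i) ->
  (p * q)`_n = fps_mul u v n.
Proof.
move=> hp hq; rewrite coefM; apply: eq_bigr => i _.
by rewrite hp ?hq ?leq_subr // -ltnS ltn_ord.
Qed.

Fact fps_mulA : associative fps_mul.
Proof.
move=> u v w; apply/funext => n; pose t := fps_trunc n.+1.
have tE x i : (i <= n)%N -> (t x)`_i = x i by move=> ?; rewrite fps_truncE.
rewrite -(@fps_mul_coefM _ _ (t u) (t v * t w)); first last.
- by move=> i le_in; apply: fps_mul_coefM => j le_ji; apply: tE; apply: leq_trans le_in.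
- by move=> i; apply: tE.
rewrite mulrA; apply: fps_mul_coefM => i le_in; last exact: tE.
by apply: fps_mul_coefM => j le_ji; apply: tE; apply: leq_trans le_in.
Qed.

Fact fps_mulC : commutative fps_mul.
Proof.
move=> u v; apply/funext => n; pose t := fps_trunc n.+1.
have tE x i : (i <= n)%N -> (t x)`_i = x i by move=> ?; rewrite fps_truncE.
have tM x y : (t x * t y)`_n = fps_mul x y n by apply: fps_mul_coefM => i; apply: tE.
by rewrite -!tM mulrC.
Qed.

Fact fps_mul1 : left_id (fps_of_poly 1) fps_mul.
Proof.
move=> u; apply/funext => n; rewrite -(@fps_mul_coefM _ _ 1 (fps_trunc n.+1 u)) //.
  by rewrite mul1r fps_truncE.
by move=> i le_in; rewrite fps_truncE.
Qed.

Fact fps_mulDl : left_distributive fps_mul +%R.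
Proof.
move=> u v w; apply/funext => n; rewrite /fps_mul -[RHS]big_split /=.
by apply: eq_bigr => i _; rewrite mulrDl.
Qed.

Fact fps_one_neq0 : fps_of_poly 1 != 0 :> fps K.
Proof. by apply/eqP => /(congr1 (fun u : fps K => u 0%N))/eqP; rewrite /fps_of_poly coef1 oner_eq0. Qed.

HB.instance Definition _ := GRing.Zmodule_isComNzRing.Build (fps K)
  fps_mulA fps_mulC fps_mul1 fps_mulDl fps_one_neq0.

Fact fps_of_poly_is_zmod_morphism : zmod_morphism fps_of_poly.
Proof. by move=> p q; apply/funext => n; rewrite /fps_of_poly coefB. Qed.

Fact fps_of_poly_is_monoid_morphism : monoid_morphism fps_of_poly.
Proof. by split=> // p q; apply/funext => n; apply: fps_mul_coefM. Qed.

HB.instance Definition _ := GRing.isZmodMorphism.Build {poly K} (fps K)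
  fps_of_poly fps_of_poly_is_zmod_morphism.
HB.instance Definition _ := GRing.isMonoidMorphism.Build {poly K} (fps K)
  fps_of_poly fps_of_poly_is_monoid_morphism.

Lemma fpsM u v n : (u * v) n = \sum_(i < n.+1) u i * v (n - i)%N.
Proof. by []. Qed.

Lemma fpsD u v n : (u + v) n = u n + v n. Proof. by []. Qed.

Lemma fps_sum (I : Type) (r : seq I) (P : pred I) (F : I -> fps K) n :
  (\sum_(i <- r | P i) F i) n = \sum_(i <- r | P i) F i n.
Proof. by elim/big_rec2: _ => // i y1 y2 _ <-. Qed.

Definition fps_const0 u : K := u 0%N.

Fact fps_const0_is_zmod_morphism : zmod_morphism fps_const0.
Proof. by []. Qed.

Fact fps_const0_is_monoid_morphism : monoid_morphism fps_const0.
Proof. by split=> [|u v]; rewrite /fps_const0 ?fpsM ?big_ord1 //= [LHS]coef1. Qed.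

HB.instance Definition _ := GRing.isZmodMorphism.Build (fps K) K
  fps_const0 fps_const0_is_zmod_morphism.
HB.instance Definition _ := GRing.isMonoidMorphism.Build (fps K) K
  fps_const0 fps_const0_is_monoid_morphism.

Definition fps_deriv u : fps K := fun n => u n.+1 *+ n.+1.

Fact fps_deriv_is_zmod_morphism : zmod_morphism fps_deriv.
Proof. by move=> u v; apply/funext => n; rewrite /fps_deriv -[RHS]mulrnBl. Qed.

HB.instance Definition _ := GRing.isZmodMorphism.Build (fps K) (fps K)
  fps_deriv fps_deriv_is_zmod_morphism.

Lemma fps_derivM u v : fps_deriv (u * v) = fps_deriv u * v + u * fps_deriv v.
Proof.
apply/funext => n; pose t := fps_trunc n.+2.
have tE x i : (i <= n.+1)%N -> (t x)`_i = x i by move=> ?; rewrite fps_truncE.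
have dE x i : (i <= n)%N -> (t x)^`()`_i = fps_deriv x i.
  by move=> le_in; rewrite coef_deriv tE.
rewrite {1}/fps_deriv -[(u * v) _](@fps_mul_coefM _ _ (t u) (t v)); try exact: tE.
rewrite -coef_deriv derivM coefD; congr (_ + _); apply: fps_mul_coefM => i le_in;
  by [exact: dE | apply: tE; exact: leqW].
Qed.

Lemma fps_deriv_of_poly p : fps_deriv (fps_of_poly p) = fps_of_poly p^`().
Proof. by apply/funext => n; rewrite /fps_of_poly coef_deriv. Qed.

Lemma iter_fps_deriv m u n : iter m fps_deriv u n = u (m + n)%N *+ (m + n) ^_ m.
Proof.
elim: m n => [|m IHm] n; first by rewrite ffactn0.
rewrite iterS /fps_deriv IHm addnS -mulrnA; congr (_ *+ _).
by rewrite ffactnSr addSn subSn ?leq_addr // addKn.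
Qed.

End PowerSeries.

(** If both factors were nonzero, of orders [m] and [n], the coefficient of index [m + n] of the
    product would be the product of the two lowest coefficients, hence nonzero. *)
Lemma fps_mul_eq0 (K : idomainType) (u v : fps K) : u * v = 0 -> u = 0 \/ v = 0.
Proof.
have order (w : fps K) : w <> 0 ->
    exists n, w n != 0 /\ forall i, (i < n)%N -> w i = 0.
  move=> w0; have [n0 wn0] : exists n, w n != 0.
    apply: contra_notP w0 => w0; apply/funext => n; apply: contra_notP w0.
    by move=> /eqP wn; exists n.
  have [n wn min_n] := @find_ex_minn (fun n => w n != 0) (ex_intro _ n0 wn0).
  exists n; split=> // i lt_in; apply/eqP; apply: contraTT lt_in => wi.
  by rewrite -leqNgt min_n.
move=> uv0; have [->|/order[m [um minm]]] := pselect (u = 0); first by left.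
have [->|/order[n [vn minn]]] := pselect (v = 0); first by right.
have /eqP := congr1 (fun w : fps K => w (m + n)%N) uv0.
rewrite fpsM (bigD1 (inord m)) //= big1 => [|i]; last first.
  rewrite -val_eqE /= inordK ?ltnS ?leq_addr // neq_ltn => /orP[lt_im|lt_mi].
    by rewrite minm // mul0r.
  by rewrite minn ?mulr0 //; have := ltn_ord i; lia.
by rewrite inordK ?ltnS ?leq_addr // addKn addr0 mulf_eq0 (negPf um) (negPf vn).
Qed.

(** * Finitely generated modules over polynomials *)

Section Span.
Variables (K : fieldType) (A : comNzRingType) (tau : {rmorphism {poly K} -> A}).
Implicit Types (w : seq A) (x y : A) (c : {poly K}).

(** Membership in the [{poly K}]-submodule of [A] generated by the list [w], polynomials acting
    through [tau]. Peeling off one generator at a time makes induction on [w] available. *)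
Fixpoint polyspan w x : Prop :=
  if w is y :: w' then exists c, polyspan w' (x - tau c * y) else x = 0.

Lemma polyspan0 w : polyspan w 0.
Proof. by elim: w => //= y w IHw; exists 0; rewrite rmorph0 mul0r subr0. Qed.

Lemma polyspanD w x y : polyspan w x -> polyspan w y -> polyspan w (x + y).
Proof.
elim: w x y => /= [|z w IHw] x y; first by move=> -> ->; rewrite addr0.
move=> [a xa] [b yb]; exists (a + b); rewrite rmorphD mulrDl opprD addrACA.
exact: IHw.
Qed.

Lemma polyspanZ w c x : polyspan w x -> polyspan w (tau c * x).
Proof.
elim: w x => /= [|z w IHw] x; first by move=> ->; rewrite mulr0.
by move=> [a xa]; exists (c * a); rewrite rmorphM -mulrA -mulrBr; apply: IHw.
Qed.

Lemma polyspanN w x : polyspan w x -> polyspan w (- x).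
Proof. by move=> /(polyspanZ (-1)); rewrite rmorphN1 mulN1r. Qed.

Lemma polyspan_sum w (I : Type) (r : seq I) (P : pred I) (F : I -> A) :
  (forall i, P i -> polyspan w (F i)) -> polyspan w (\sum_(i <- r | P i) F i).
Proof.
by move=> wF; elim/big_ind: _ => //; [exact: polyspan0 | exact: polyspanD].
Qed.

Lemma polyspan_mem w x : x \in w -> polyspan w x.
Proof.
elim: w => //= y w IHw; rewrite in_cons => /predU1P[->|/IHw wx].
  by exists 1; rewrite rmorph1 mul1r subrr; apply: polyspan0.
by exists 0; rewrite rmorph0 mul0r subr0.
Qed.

Lemma polyspan_catr w1 w2 x : polyspan w2 x -> polyspan (w1 ++ w2) x.
Proof.
by elim: w1 => //= y w1 IHw w2x; exists 0; rewrite rmorph0 mul0r subr0; apply: IHw.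
Qed.

Lemma polyspan_catl w1 w2 x : polyspan w1 x -> polyspan (w1 ++ w2) x.
Proof.
elim: w1 x => /= [|y w1 IHw] x; first by move=> ->; apply: polyspan0.
by move=> [c /IHw]; exists c.
Qed.

(** Let [g] be a nonzero element of least size in the ideal generated by the [a i]. By Euclidean
    division it divides every [a i], and it is itself a combination of finitely many of them. *)
Lemma poly_ideal_fg (a : nat -> {poly K}) : exists n, forall i,
  exists b : nat -> {poly K}, a i = \sum_(j < n) b j * a j.
Proof.
pose I (p : {poly K}) := exists n (b : nat -> {poly K}), p = \sum_(j < n) b j * a j.
have a_in i : I (a i).
  exists i.+1, (fun j : nat => (j == i)%:R).
  rewrite (bigD1 ord_max) //= eqxx mul1r big1 ?addr0 // => j /negPf.
  by rewrite -val_eqE => /= ->; rewrite mul0r.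
have Iext n (b : nat -> {poly K}) m : (n <= m)%N ->
    \sum_(j < n) b j * a j = \sum_(j < m) (if (j < n)%N then b j else 0) * a j.
  move=> le_nm; rewrite (big_ord_widen _ (fun j => b j * a j) le_nm) big_mkcond.
  by apply: eq_bigr => j _; case: ifP; rewrite ?mul0r.
have ID p q c : I p -> I q -> I (p - c * q).
  move=> [n [b ->]] [m [b' ->]]; exists (maxn n m).
  rewrite (Iext n _ _ (leq_maxl n m)) (Iext m _ _ (leq_maxr n m)).
  rewrite mulr_sumr -sumrB.
  pose d (j : nat) := (if (j < n)%N then b j else 0) - c * (if (j < m)%N then b' j else 0).
  by exists d; apply: eq_bigr => j _; rewrite mulrBl !mulrA.
have [a0|[i0 ai0]] : (forall i, a i = 0) \/ exists i, a i != 0.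
  have [a0|] := pselect (forall i, a i = 0); first by left.
  by move=> /existsNP[i /eqP ai]; right; exists i.
  by exists 0%N => i; exists (fun=> 0); rewrite a0 big_ord0.
pose S n := `[< exists p, [/\ I p, p != 0 & size p = n] >].
have exS : exists n, S n by exists (size (a i0)); apply/asboolP; exists (a i0).
have [n /asboolP[g [[k [b gE]] g0 gn]] min_n] := find_ex_minn exS.
exists k => i; have := divp_eq (a i) g; set q := _ %/ _; set r := _ %% _ => aE.
have r0 : r = 0.
  apply/eqP; apply: contraT => r0; have : (n <= size r)%N.
    apply: min_n; apply/asboolP; exists r; split=> //.
    have -> : r = a i - q * g by rewrite aE addrC addKr.
    by apply: ID => //; exists k, b.
  by rewrite leqNgt -gn ltn_modp g0.
exists (fun j => q * b j); rewrite aE r0 addr0 {1}gE mulr_sumr.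
by apply: eq_bigr => j _; rewrite mulrA.
Qed.

(** The chain condition in the form used later: for successive derivatives it yields a linear
    differential equation with leading coefficient 1. By induction on the generators: the
    coordinates on [y] generate a finitely generated ideal, and subtracting combinations of the
    first [n] terms kills them. *)
Lemma polyspan_noetherian w (v : nat -> A) : (forall i, polyspan w (v i)) ->
  exists n (c : nat -> {poly K}), v n = \sum_(j < n) tau (c j) * v j.
Proof.
elim: w v => [|y w IHw] v /= wv.
  by exists 0%N, (fun=> 0); rewrite big_ord0; apply: wv.
have [a va] := choice wv; have [n /choice[b bE]] := poly_ideal_fg a.
pose v' i := v i - \sum_(j < n) tau (b i j) * v j.
have wv' i : polyspan w (v' i).
  have -> : v' i = (v i - tau (a i) * y) - \sum_(j < n) tau (b i j) * (v j - tau (a j) * y).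
    under [in RHS]eq_bigr do rewrite mulrBr; rewrite sumrB (bE i) rmorph_sum mulr_suml.
    under [X in v i - X - _]eq_bigr do rewrite rmorphM -mulrA.
    by rewrite /v'; ring.
  apply: polyspanD => //; apply: polyspanN; apply: polyspan_sum => j _; exact: polyspanZ.
have [m [c cE]] := IHw (fun i => v' (n + i)%N) (fun i => wv' _).
(* Unfolding the relation among the [v' (n + i)] gives one among the [v i]: the corrections only
   affect the coefficients of the first [n] terms. *)
exists (n + m)%N, (fun k => if (k < n)%N then b (n + m)%N k - \sum_(j < m) c j * b (n + j)%N k
                    else c (k - n)%N).
rewrite big_split_ord /=.
under eq_bigr do rewrite ltn_ord.
under [X in _ + X]eq_bigr do rewrite ltnNge leq_addr /= addKn.
move: cE; rewrite /v' => /(canRL (subrK _)) ->.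
under [in LHS]eq_bigr do rewrite mulrBr.
rewrite sumrB.
under [in RHS]eq_bigr do rewrite rmorphB mulrBl rmorph_sum mulr_suml.
rewrite sumrB [in RHS]exchange_big /=.
under [X in _ = _ - X + _]eq_bigr do
  (under eq_bigr do rewrite rmorphM -mulrA; rewrite -mulr_sumr).
by ring.
Qed.

End Span.

(** * Denominators of the derivatives of an algebraic element *)

Section Denominators.
Variables (K : fieldType) (A : comNzRingType) (tau : {rmorphism {poly K} -> A}).
Variable d : {additive A -> A}.
Hypothesis dM : forall x y, d (x * y) = d x * y + x * d y.
Hypothesis d_tau : forall p, d (tau p) = tau p^`().
Implicit Types (w : seq A) (x y u : A) (c E D : {poly K}) (P Q : {poly {poly K}}).

(* Away from the zeros of [E], [u] is integral and unramified. *)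
Definition bounded_denom E w u : Prop :=
  forall m, exists n, polyspan tau w (tau E ^+ n * iter m d u).

Lemma polyspan_exp E w x n m : (n <= m)%N ->
  polyspan tau w (tau E ^+ n * x) -> polyspan tau w (tau E ^+ m * x).
Proof.
by move=> le_nm wx; rewrite -(subnK le_nm) exprD -mulrA -rmorphXn; apply: polyspanZ.
Qed.

Lemma iter_derD m x y : iter m d (x + y) = iter m d x + iter m d y.
Proof. by elim: m => //= m ->; rewrite raddfD. Qed.

Lemma bounded_denomD E w x y :
  bounded_denom E w x -> bounded_denom E w y -> bounded_denom E w (x + y).
Proof.
move=> bx by_ m; have [[n xn] [n' yn]] := (bx m, by_ m).
exists (maxn n n'); rewrite iter_derD mulrDr.
by apply: polyspanD; [apply: polyspan_exp xn | apply: polyspan_exp yn]; rewrite leq_max leqnn ?orbT.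
Qed.

Lemma bounded_denom0 E w : bounded_denom E w 0.
Proof.
move=> m; exists 0%N; suff -> : iter m d 0 = 0 by rewrite mulr0; apply: polyspan0.
by elim: m => //= m ->; rewrite raddf0.
Qed.

Lemma bounded_denomZ E w c x :
  bounded_denom E w x -> bounded_denom E w (tau c * x).
Proof.
move=> bx m; elim: m c x bx => [|m IHm] c x bx.
  by have [n xn] := bx 0%N; exists n; rewrite mulrCA; apply: polyspanZ.
have bdx : bounded_denom E w (d x) by move=> k; rewrite -iterSr; apply: bx.
have [[n1 h1] [n2 h2]] := (IHm c^`() x bx, IHm c (d x) bdx).
exists (maxn n1 n2); rewrite iterSr dM d_tau iter_derD mulrDr.
by apply: polyspanD; [apply: polyspan_exp h1 | apply: polyspan_exp h2]; rewrite leq_max leqnn ?orbT.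
Qed.

Lemma bounded_denom_mull E E' w x :
  bounded_denom E w x -> bounded_denom (E' * E) w x.
Proof.
move=> bx m; have [n xn] := bx m; exists n.
by rewrite rmorphM exprMn -mulrA -rmorphXn; apply: polyspanZ.
Qed.

Lemma bounded_denom_catl E w w' x :
  bounded_denom E w x -> bounded_denom E (w ++ w') x.
Proof. by move=> bx m; have [n xn] := bx m; exists n; apply: polyspan_catl. Qed.

Lemma bounded_denom_catr E w w' x :
  bounded_denom E w' x -> bounded_denom E (w ++ w') x.
Proof. by move=> bx m; have [n xn] := bx m; exists n; apply: polyspan_catr. Qed.

Lemma bounded_denom_sum n (E c : nat -> {poly K}) (x : nat -> A) :
  (forall k, (k < n)%N -> exists w, bounded_denom (E k) w (x k)) ->
  exists w, bounded_denom (\prod_(k < n) E k) w (\sum_(k < n) tau (c k) * x k).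
Proof.
elim: n => [|n IHn] bx; first by exists [::]; rewrite !big_ord0; apply: bounded_denom0.
have [w bw] := IHn (fun k lt_kn => bx k (leqW lt_kn)).
have [w' bw'] := bx n (leqnn _).
exists (w ++ w'); rewrite !big_ord_recr /=; apply: bounded_denomD.
  by rewrite mulrC; apply: bounded_denom_mull; apply: bounded_denom_catl.
by apply: bounded_denom_mull; apply: bounded_denom_catr; apply: bounded_denomZ.
Qed.

(** Bezout's identity between powers of [E1] and [E2] cancels both denominators, so one finitely
    generated module contains every derivative of [x]. *)
Lemma bounded_denom_coprime E1 E2 w1 w2 x : coprimep E1 E2 ->
  bounded_denom E1 w1 x -> bounded_denom E2 w2 x ->
  forall m, polyspan tau (w1 ++ w2) (iter m d x).
Proof.
move=> co12 b1 b2 m; have [[n1 h1] [n2 h2]] := (b1 m, b2 m).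
have /Bezout_eq1_coprimepP[[u v] /= uv1] : coprimep (E1 ^+ n1) (E2 ^+ n2).
  exact/coprimep_expl/coprimep_expr.
rewrite -[iter m d x]mul1r -(rmorph1 tau) -uv1 rmorphD !rmorphM !rmorphXn mulrDl -!mulrA.
by apply: polyspanD; apply: polyspanZ; [apply: polyspan_catl | apply: polyspan_catr].
Qed.

(** Differentiating the equation writes [d x] as a quotient by the value at [x] of the derivative of
    [P]; the Bezout relation turns this denominator into [D0]. So every iterated derivative is a
    polynomial in [x] over a power of [D0], and pseudo-division by [P] bounds its degree at the cost
    of a power of the leading coefficient. *)
Lemma bounded_denom_root P x (D0 : {poly K}) : P != 0 -> (map_poly tau P).[x] = 0 ->
    (exists U V, U * P + V * P^`() = D0%:P) ->
  exists w, bounded_denom (D0 * lead_coef P) w x.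
Proof.
move=> P0 Px0 [U [V UVD]]; pose ev Q := (map_poly tau Q).[x].
have evD Q1 Q2 : ev (Q1 + Q2) = ev Q1 + ev Q2 by rewrite /ev rmorphD hornerD.
have evM Q1 Q2 : ev (Q1 * Q2) = ev Q1 * ev Q2 by rewrite /ev rmorphM hornerM.
have evC c : ev c%:P = tau c by rewrite /ev map_polyC hornerC.
have evN Q : ev (- Q) = - ev Q by rewrite /ev rmorphN hornerN.
have evX : ev 'X = x by rewrite /ev map_polyX hornerX.
(* Chain rule: [Q'] collects the derivatives of the coefficients of [Q]. *)
have dev Q : exists Q', d (ev Q) = ev Q' + ev Q^`() * d x.
  elim/poly_ind: Q => [|Q c [Q' dQ]].
    by exists 0; rewrite -[0]/((0 : {poly K})%:P) derivC !evC rmorph0 raddf0 mul0r addr0.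
  exists (Q' * 'X + c^`()%:P).
  by rewrite derivD derivM derivX derivC !(evD, evM, evC, evX) !raddfD /= dM dQ d_tau !rmorph1 !rmorph0; ring.
have evP : ev P = 0 by []. have [P' dP] := dev P; rewrite evP raddf0 in dP.
have dx : tau D0 * d x = ev (- (V * P')).
  have /(congr1 ev) := UVD; rewrite evD !evM evC evP mulr0 add0r => <-.
  rewrite -mulrA (_ : _ * d x = - ev P'); first by rewrite evN evM mulrN.
  by apply/eqP; rewrite eq_sym eqr_oppLR -addr_eq0 -dP.
have dxE : tau D0 * d x = - (ev V * ev P') by rewrite dx evN evM.
pose frac y := exists n Q, tau D0 ^+ n * y = ev Q.
have frac_d y : frac y -> frac (d y).
  move=> [n [Q yQ]]; have [Q' dQ] := dev Q; exists n.+1.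
  exists (D0%:P * Q' + Q^`() * (- (V * P')) - (D0^`() *+ n)%:P * Q).
  have DdDn : tau D0 * d (tau D0 ^+ n) = tau (D0^`() *+ n) * tau D0 ^+ n.
    rewrite -!rmorphXn d_tau -!rmorphM deriv_exp; congr (tau _).
    by case: n {yQ} => [|n]; rewrite ?mulr0n ?mul0r ?mulr0 //= exprS !mulrnAr mulrnAl mulrCA.
  have /(congr1 ( *%R (tau D0))) := congr1 d yQ; rewrite dQ dM mulrDr mulrA DdDn -mulrA yQ => dy.
  rewrite !(evD, evN, evM, evC) -dxE exprS -mulrA.
  by rewrite -[LHS](addrK (tau (D0^`() *+ n) * ev Q)) [X in X - _]addrC dy; ring.
have frac_iter m : frac (iter m d x).
  elim: m => [|m]; last exact: frac_d.
  by exists 0%N, 'X; rewrite evX mul1r.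
exists [seq x ^+ i | i <- iota 0 (size P)] => m; have [n [Q mQ]] := frac_iter m.
have PQ := Pdiv.ComRing.rdivp_eq P Q; set k := Pdiv.Ring.rscalp Q P in PQ.
have lt_rP : (size (Pdiv.Ring.rmodp Q P) < size P)%N.
  by rewrite Pdiv.Ring.ltn_rmodp.
exists (n + k)%N; set r := Pdiv.Ring.rmodp Q P in PQ lt_rP.
have -> : tau (D0 * lead_coef P) ^+ (n + k) * iter m d x = tau (D0 ^+ k * lead_coef P ^+ n) * ev r.
  have <- : ev (lead_coef P ^+ k *: Q) = ev r by rewrite PQ evD evM evP mulr0 add0r.
  rewrite -mul_polyC evM evC -mQ !(rmorphM, rmorphXn) exprMn !exprD.
  move: (_ ^+ n) (_ ^+ k) (_ ^+ n) (_ ^+ k) (iter m d x) => a b e g y; ring.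
apply: polyspanZ; rewrite /ev (horner_coef_wide _ (leq_trans (size_poly _ _) (ltnW lt_rP))).
apply: polyspan_sum => i _; rewrite coef_map; apply: polyspanZ; apply: polyspan_mem.
by apply/mapP; exists (nat_of_ord i); rewrite // mem_iota /=.
Qed.

End Denominators.

(** * Growth of algebraic power series *)

Section EntireAlgebraic.
Variable C : numClosedFieldType.
Hypothesis archi : forall x : C, exists n : nat, `|x| <= n%:R.
Implicit Types (p q : {poly C}) (x t : C) (g : fps C).

(** A weighted l1 norm of the coefficients: submultiplicative, and an upper bound for [p] on the
    circle of radius [x]. It stands in for the supremum norm. *)
Definition wnorm x p := (map_poly (fun y => `|y|) p).[x].

Lemma coef_map_norm p i : (map_poly (fun y => `|y|) p)`_i = `|p`_i|.
Proof. by rewrite coef_map_id0 // normr0. Qed.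

Lemma wnorm_wide n p x : (size p <= n)%N -> wnorm x p = \sum_(i < n) `|p`_i| * x ^+ i.
Proof.
move=> le_pn; rewrite /wnorm (@horner_coef_wide _ n) ?(leq_trans (size_poly _ _)) //.
by apply: eq_bigr => i _; rewrite coef_map_norm.
Qed.

Lemma wnorm_ge0 p x : 0 <= x -> 0 <= wnorm x p.
Proof.
by move=> x0; rewrite (wnorm_wide _ (leqnn _)) sumr_ge0 // => i _; rewrite mulr_ge0 ?exprn_ge0.
Qed.

Lemma ler_horner_coef p q x : 0 <= x -> (forall i, p`_i <= q`_i) -> p.[x] <= q.[x].
Proof.
move=> x0 pq; rewrite (horner_coef_wide x (leq_maxl (size p) (size q))).
rewrite (horner_coef_wide x (leq_maxr (size p) (size q))).
by apply: ler_sum => i _; rewrite ler_wpM2r ?exprn_ge0.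
Qed.

Lemma wnormD p q x : 0 <= x -> wnorm x (p + q) <= wnorm x p + wnorm x q.
Proof.
move=> x0; rewrite -hornerD; apply: ler_horner_coef => // i.
by rewrite coefD !coef_map_norm coefD ler_normD.
Qed.

Lemma wnorm_sum n (F : nat -> {poly C}) x : 0 <= x ->
  wnorm x (\sum_(i < n) F i) <= \sum_(i < n) wnorm x (F i).
Proof.
move=> x0; elim: n => [|n IHn]; first by rewrite !big_ord0 /wnorm map_poly0 horner0.
rewrite !big_ord_recr /=; apply: le_trans (wnormD _ _ x0) _; exact: lerD.
Qed.

Lemma wnormM p q x : 0 <= x -> wnorm x (p * q) <= wnorm x p * wnorm x q.
Proof.
move=> x0; rewrite -hornerM; apply: ler_horner_coef => // i.
rewrite coef_map_norm !coefM; apply: le_trans (ler_norm_sum _ _ _) _.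
by apply: ler_sum => j _; rewrite !coef_map_norm normrM.
Qed.

Lemma wnormX p n x : 0 <= x -> wnorm x (p ^+ n) <= wnorm x p ^+ n.
Proof.
move=> x0; elim: n => [|n IHn].
  by rewrite !expr0 (wnorm_wide _ (leqnn _)) size_poly1 big_ord1 coef1 normr1 mulr1.
rewrite !exprS; apply: le_trans (wnormM _ _ x0) _.
by rewrite ler_wpM2l // wnorm_ge0.
Qed.

Lemma horner_le_wnorm p t : `|p.[t]| <= wnorm `|t| p.
Proof.
rewrite horner_coef (wnorm_wide _ (leqnn _)); apply: le_trans (ler_norm_sum _ _ _) _.
by apply: ler_sum => i _; rewrite normrM normrX.
Qed.

Lemma partial_le_wnorm n p x : 0 <= x -> \sum_(i < n) `|p`_i| * x ^+ i <= wnorm x p.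
Proof.
move=> x0; rewrite (wnorm_wide _ (leq_maxr n (size p))).
rewrite (big_ord_widen _ (fun i => `|p`_i| * x ^+ i) (leq_maxl n (size p))) big_mkcond.
by apply: ler_sum => i _; case: ifP => // _; rewrite mulr_ge0 ?exprn_ge0.
Qed.

(** A substitute for the Schwarz lemma: each surviving monomial has degree at least [n] and gains a
    factor of at least [2 ^ n] when the radius doubles. *)
Lemma wnorm_double p x n : 0 <= x -> (forall i, (i < n)%N -> p`_i = 0) ->
  2 ^+ n * wnorm x p <= wnorm (2 * x) p.
Proof.
move=> x0 p0; rewrite !(wnorm_wide _ (leqnn _)) mulr_sumr; apply: ler_sum => i _.
have [lt_in|le_ni] := ltnP i n; first by rewrite p0 // normr0 !mul0r mulr0.
rewrite mulrCA ler_wpM2l // exprMn ler_wpM2r ?exprn_ge0 //.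
by rewrite ler_weXn2l ?ler1n.
Qed.

Lemma prim_root_exists n : (0 < n)%N -> exists z : C, n.-primitive_root z.
Proof.
move=> n_gt0; pose p : {poly C} := 'X^n - 1; have [r Dp] := closed_field_poly_normal p.
move: Dp; rewrite lead_coefXnsubC // scale1r => Dp.
have rn1 : all n.-unity_root r by apply/allP=> z; rewrite -root_prod_XsubC -Dp.
have sz_r : (n < (size r).+1)%N by rewrite -(size_prod_XsubC r id) -Dp size_XnsubC.
have [|z _ zP] := hasP (has_prim_root n_gt0 rn1 _ sz_r); last by exists z.
by rewrite -separable_prod_XsubC -Dp separable_Xn_sub_1 // pnatr_eq0 -lt0n.
Qed.

Lemma sum_prim_root n (z : C) k : n.-primitive_root z -> ~~ (n %| k)%N ->
  \sum_(j < n) z ^+ k ^+ j = 0.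
Proof.
move=> prim_z; rewrite (prim_order_dvd prim_z) => zk1.
have := subrX1 (z ^+ k) n; rewrite -exprM mulnC exprM (prim_expr_order prim_z) expr1n subrr.
by move=> /esym/eqP; rewrite mulf_eq0 subr_eq0 (negPf zk1) => /eqP.
Qed.

(** Cauchy's estimate, with the integral over the circle replaced by the mean over the [n]-th roots
    of unity; this is exact because [n] exceeds both the degree of [p] and the index [m]. *)
Lemma coef_cauchy p x B m : 0 <= x ->
  (forall t, `|t| = x -> `|p.[t]| <= B) -> `|p`_m| * x ^+ m <= B.
Proof.
move=> x0 pB; pose n := maxn (size p) m.+1.
have n_gt0 : (0 < n)%N by rewrite leq_max orbT.
have lt_mn : (m < n)%N by rewrite leq_max ltnSn orbT.
have [z prim_z] := prim_root_exists n_gt0.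
have z1 : `|z| = 1.
  by apply/eqP; rewrite -(pexpr_eq1 n_gt0) // -normrX (prim_expr_order prim_z) normr1.
(* The exponent [n - m] stands for [- m] modulo [n]: only the term of index [m] survives the
   averaging. *)
have coefE : p`_m * x ^+ m *+ n = \sum_(j < n) p.[x * z ^+ j] * z ^+ (j * (n - m)).
  under eq_bigr do rewrite (horner_coef_wide _ (leq_maxl _ m.+1)) mulr_suml.
  rewrite exchange_big (bigD1 (Ordinal lt_mn)) //= [X in _ + X]big1 => [|i ne_im].
    rewrite addr0 (eq_bigr (fun=> p`_m * x ^+ m)) ?sumr_const ?card_ord // => j _.
    rewrite exprMn -!mulrA -exprM -exprD -mulnDr subnKC 1?ltnW // mulnC exprM.
    by rewrite (prim_expr_order prim_z) expr1n mulr1.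
  rewrite (eq_bigr (fun j : 'I_n => p`_i * x ^+ i * z ^+ (i + (n - m)) ^+ j)); last first.
    by move=> j _; rewrite exprMn -!mulrA -!exprM -exprD -mulnDr [(_ * j)%N]mulnC.
  rewrite -mulr_sumr sum_prim_root ?mulr0 //; apply: contra ne_im => /dvdnP[k kE].
  have lt_in := ltn_ord i; rewrite -val_eqE /=; apply/eqP.
  by case: k kE => [|[|k]]; rewrite ?mulSn; lia.
have : `|p`_m| * x ^+ m *+ n <= B *+ n.
  rewrite -[x]ger0_norm // -normrX -normrM -normrMn coefE.
  apply: le_trans (ler_norm_sum _ _ _) _; rewrite -[n in X in _ <= X]card_ord -sumr_const.
  apply: ler_sum => j _; rewrite normrM normrX z1 expr1n mulr1; apply: pB.
  by rewrite normrM normrX z1 expr1n mulr1 ger0_norm.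
by rewrite lerMn2r; case: n n_gt0 {lt_mn prim_z coefE}.
Qed.

Lemma leq_ffactD m j n : (j <= n)%N -> ((j + m) ^_ j <= (n + m) ^_ n)%N.
Proof.
elim: n => [|n IHn]; first by rewrite leqn0 => /eqP ->.
rewrite leq_eqVlt => /predU1P[->//|/IHn le_jn]; apply: leq_trans le_jn _.
by rewrite addSn ffactSS leq_pmull.
Qed.

(** Comparing coefficients gives a recurrence for [g] whose leading falling factorial has one factor
    [m] more than the others. For large [m] this factor beats every constant, so the weighted
    coefficients [b m] stay below a bound for the first ones. *)
Lemma entire_of_monic_ode g n (r : nat -> {poly C}) :
    iter n (@fps_deriv C) g =
      \sum_(j < n) fps_of_poly (r j) * iter j (@fps_deriv C) g ->
  forall a : nat, (0 < a)%N -> exists B, 0 <= B /\ forall m, `|g m| * a%:R ^+ m <= B.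
Proof.
case: n => [|n] ode a a_gt0.
  rewrite big_ord0 /= in ode; exists 0; split=> // m.
  by rewrite ode normr0 mul0r.
pose b m : C := `|g m| * a%:R ^+ m.
have b0 m : 0 <= b m by rewrite mulr_ge0 ?exprn_ge0 ?ler0n.
(* [L] bounds the total contribution of the [r j]. The threshold [M] ensures [L <= m], and
   [n.+1 <= m] so that the equation determines [g m]. *)
pose L : C := a%:R ^+ n.+1 * \sum_(j < n.+1) wnorm a%:R (r j).
have [M0 LM0] := archi L; pose M := (n.+1 + M0)%N.
have [B [B0 BM]] : exists B, 0 <= B /\ forall m, (m < M)%N -> b m <= B.
  exists (\sum_(i < M) b i); split=> [|m lt_mM]; first by rewrite sumr_ge0.
  by rewrite (bigD1 (Ordinal lt_mM)) //= lerDl sumr_ge0.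
exists B; split=> // m; rewrite -/(b m); elim/ltn_ind: m => m IHm.
have [/BM//|le_Mm] := ltnP m M.
have [k mE] : exists k, m = (n.+1 + k)%N.
  by exists (m - n.+1)%N; rewrite subnKC // (leq_trans _ le_Mm) // leq_addr.
pose F : C := ((n + k) ^_ n)%:R.
have F0 : 0 < F by rewrite ltr0n ffact_gt0 leq_addr.
(* The coefficient of index [k] of the equation: the falling factorials on the right are at most
   [F], and [1 <= a] allows exponents of [a] to be raised. *)
have main : m%:R * F * b m <= F * (L * B).
  have /(congr1 (fun u : fps C => u k)) := ode; rewrite iter_fps_deriv -mE fps_sum.
  have -> : (m ^_ n.+1 = m * (n + k) ^_ n)%N by rewrite mE addSn ffactSS.
  rewrite -[_ *+ (m * _)]mulr_natr natrM => gE.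
  have -> : m%:R * F * b m = `|g m * (m%:R * F)| * a%:R ^+ m.
    by rewrite /b normrM (ger0_norm (_ : 0 <= m%:R * F)) ?mulr_ge0 ?ler0n ?ltW //; ring.
  rewrite gE /L !mulr_sumr !mulr_suml mulr_sumr.
  apply: le_trans (_ : \sum_(j < n.+1) `|(fps_of_poly (r j) * iter j (@fps_deriv C) g) k| * a%:R ^+ m <= _).
    by rewrite -mulr_suml ler_wpM2r ?exprn_ge0 ?ler0n // ler_norm_sum.
  apply: ler_sum => j _; rewrite fpsM.
  apply: le_trans (_ : \sum_(i < k.+1) F * (a%:R ^+ n.+1 * (`|(r j)`_i| * a%:R ^+ i) * B) <= _); last first.
    rewrite -mulr_sumr ler_wpM2l ?(ltW F0) // -mulr_suml ler_wpM2r // -mulr_sumr.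
    by rewrite ler_wpM2l ?exprn_ge0 ?ler0n // partial_le_wnorm // ler0n.
  apply: le_trans (_ : \sum_(i < k.+1)
      `|fps_of_poly (r j) i * iter j (@fps_deriv C) g (k - i)%N| * a%:R ^+ m <= _).
    by rewrite -mulr_suml ler_wpM2r ?exprn_ge0 ?ler0n // ler_norm_sum.
  apply: ler_sum => i _; rewrite iter_fps_deriv normrM normrMn.
  have le_jn : (j <= n)%N by rewrite -ltnS.
  have le_ik : (i <= k)%N by rewrite -ltnS.
  have le_F : ((j + (k - i)) ^_ j)%:R <= F.
    rewrite ler_nat; apply: leq_trans (leq_ffactD (k - i) le_jn) _.
    by rewrite -!bin_ffact leq_mul2r leq_bin2l ?orbT // leq_add2l leq_subr.
  have le_a : a%:R ^+ m <= a%:R ^+ (n.+1 + i + (j + (k - i))) :> C.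
    by rewrite ler_weXn2l ?ler1n // mE; lia.
  have le_b : `|g (j + (k - i))%N| * a%:R ^+ (j + (k - i)) <= B by apply: IHm; rewrite mE; lia.
  rewrite [leLHS](_ : _ = (`|(r j)`_i| * `|g (j + (k - i))%N|) *
      (((j + (k - i)) ^_ j)%:R * a%:R ^+ m)); last first.
    by rewrite /fps_of_poly -[_ *+ (_ ^_ _)]mulr_natr; move: (_ ^+ m) => y; ring.
  rewrite [leRHS](_ : _ = `|(r j)`_i| * (F * (a%:R ^+ (n.+1 + i) * B))); last by rewrite exprD; ring.
  rewrite -mulrA ler_wpM2l //.
  apply: le_trans (_ : `|g (j + (k - i))%N| * (F * a%:R ^+ (n.+1 + i + (j + (k - i)))) <= _).
    by rewrite ler_wpM2l // ler_pM ?ler0n ?exprn_ge0 ?ler0n.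
  rewrite exprD mulrCA ler_wpM2l ?(ltW F0) // mulrCA ler_wpM2l ?exprn_ge0 ?ler0n //.
have m_gt0 : 0 < m%:R :> C by rewrite ltr0n mE addSn.
have LM : L <= m%:R.
  apply: le_trans (_ : M0%:R <= _); last by rewrite ler_nat (leq_trans _ le_Mm) // leq_addl.
  apply: le_trans LM0; rewrite ger0_norm // mulr_ge0 ?exprn_ge0 ?ler0n // sumr_ge0 // => j _.
  by rewrite wnorm_ge0 ?ler0n.
rewrite -(ler_pM2l (mulr_gt0 m_gt0 F0)); apply: le_trans main _.
by rewrite mulrCA -[leRHS]mulrA ler_wpM2r // mulr_ge0 ?(ltW F0).
Qed.

End EntireAlgebraic.

(** The coefficients of index at most [n] of the value at [u] depend only on those of [u], so a
    series may be replaced by a truncation. *)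
Lemma coef_horner_fps (K : comNzRingType) (Q : {poly {poly K}}) (u : fps K) (G : {poly K}) n :
  (forall i, (i <= n)%N -> G`_i = u i) ->
  forall i, (i <= n)%N -> (Q.[G])`_i = (map_poly (@fps_of_poly K) Q).[u] i.
Proof.
move=> Gu; elim/poly_ind: Q => [|Q c IHQ] i le_in; first by rewrite rmorph0 !horner0 coef0.
rewrite rmorphD rmorphM /= map_polyX map_polyC !hornerMXaddC coefD fpsD; congr (_ + _).
by apply: fps_mul_coefM => j le_ji; [apply: IHQ | apply: Gu]; apply: leq_trans le_in.
Qed.

(** * Liouville's theorem for algebraic series with infinite radius of convergence *)

Section AlgebraicEntire.
Variable C : numClosedFieldType.
Hypothesis archi : forall x : C, exists n : nat, `|x| <= n%:R.
Implicit Types (p q : {poly C}) (x t w h : C) (g : fps C).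

(** If [w] has modulus at least 1, dividing the equation by [w ^+ n.-1] bounds [w] through the
    coefficients and [h]. *)
Lemma monic_root_bound n (c : 'I_n -> C) w h : (0 < n)%N -> `|h| <= 1 ->
  \sum_(j < n) c j * w ^+ j + w ^+ n = h -> `|w| <= 1 + \sum_(j < n) `|c j|.
Proof.
case: n c => // n c _ h1 wE; set S := \sum_(j < _) `|c j|.
have S0 : 0 <= S by rewrite sumr_ge0.
have [w1|w1] : `|w| <= 1 \/ 1 <= `|w| by apply/orP/real_leVge; rewrite ?realE ?ler01 ?normr_ge0.
  by apply: le_trans w1 _; rewrite lerDl.
have wn0 : 0 < `|w| ^+ n by rewrite exprn_gt0 // (lt_le_trans ltr01).
rewrite -(ler_pM2r wn0) -exprS -normrX.
have -> : w ^+ n.+1 = h - \sum_(j < n.+1) c j * w ^+ j by rewrite -wE addrC addKr.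
apply: le_trans (ler_normB _ _) _; rewrite mulrDl mul1r; apply: lerD.
  by apply: le_trans h1 _; rewrite exprn_ege1.
apply: le_trans (ler_norm_sum _ _ _) _; rewrite mulr_suml; apply: ler_sum => j _.
by rewrite normrM normrX ler_wpM2l // ler_weXn2l // -ltnS.
Qed.

Lemma sum_half_le2 n : \sum_(i < n) 2^-1 ^+ i <= 2 :> C.
Proof.
have /(congr1 ( *%R (- 2))) := subrX1 (2^-1 : C) n.
rewrite mulrA (_ : -2 * (2^-1 - 1) = 1); last by field.
rewrite mul1r => <-; rewrite mulrBr mulr1 opprK gerDr mulNr oppr_le0.
by rewrite mulr_ge0 // exprn_ge0 // invr_ge0 ler0n.
Qed.

(* The truncation of [g] at a high order is, on the circle of radius [r], almost
   a root of [Q], hence bounded by a fixed power of [r]; Cauchy's estimate then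
   bounds the coefficients, as in Liouville's theorem. *)
Lemma algebraic_entire_is_poly g (Q : {poly {poly C}}) : Q \is monic ->
    (map_poly (@fps_of_poly C) Q).[g] = 0 ->
    (forall a : nat, (0 < a)%N -> exists B, 0 <= B /\ forall m, `|g m| * a%:R ^+ m <= B) ->
  exists p, g = fps_of_poly p.
Proof.
move=> monQ Qg entire; pose n := (size Q).-1.
have szQ : size Q = n.+1 by rewrite prednK // size_poly_gt0 monic_neq0.
have n_gt0 : (0 < n)%N.
  rewrite lt0n; apply: contra_eqN Qg => /eqP n0.
  have : (size Q <= 1)%N by rewrite szQ n0.
  move=> /size1_polyC QE; have := monicP monQ; rewrite QE lead_coefC => ->.
  by rewrite map_polyC hornerC; apply: oner_neq0.
(* [e] bounds the degrees of the coefficients of [Q], and [Bc] does not depend on the radius: [key]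
   for growing [r] kills every coefficient of index above [e]. *)
pose e := \max_(j < n) size (Q`_j)%R.
pose Bc : C := 1 + \sum_(j < n) wnorm 1 Q`_j.
have key (r m : nat) : (0 < r)%N -> `|g m| * r%:R ^+ m <= Bc * r%:R ^+ e.
  move=> r_gt0; have r1 : 1 <= r%:R :> C by rewrite ler1n.
  have r0 : 0 <= r%:R :> C by rewrite ler0n.
  have r20 : 0 <= 2 * r%:R :> C by rewrite mulr_ge0.
  have r4_gt0 : (0 < 4 * r)%N by rewrite muln_gt0.
  (* The bound at radius [4 * r] gives a geometric series of ratio 1/2 at radius [2 * r]: the norm
     of [G] is at most [2 * B] whatever the order of truncation. *)
  have [B [B0 gB]] := entire (4 * r)%N r4_gt0.
  pose K : C := \sum_(j < n.+1) wnorm (2 * r%:R) Q`_j * (2 * B) ^+ j.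
  have K0 : 0 <= K.
    by rewrite sumr_ge0 // => j _; rewrite mulr_ge0 ?wnorm_ge0 ?exprn_ge0 ?mulr_ge0.
  (* [M] is so large that [K <= 2 ^ M]: the first [M] coefficients of [H] vanish, so a bound [K] at
     radius [2 * r] becomes 1 at radius [r]. The summand [m.+1] keeps [g m] in the truncation. *)
  have [N] := archi K; rewrite ger0_norm // => KN; pose M := (N + m.+1)%N.
  pose G := fps_trunc M g; pose H := Q.[G].
  have GB : wnorm (2 * r%:R) G <= 2 * B.
    rewrite (wnorm_wide _ (size_poly _ _)).
    apply: le_trans (_ : \sum_(i < M) 2^-1 ^+ i * B <= _).
      apply: ler_sum => i _; rewrite fps_truncE //.
      apply: le_trans (ler_wpM2l _ (gB i)); last by rewrite exprn_ge0 ?invr_ge0.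
      rewrite mulrCA -exprMn natrM mulrA (_ : 2^-1 * 4%:R = 2) //.
      by field.
    by rewrite -mulr_suml ler_wpM2r // sum_half_le2.
  have HK : wnorm (2 * r%:R) H <= K.
    rewrite /H horner_coef szQ; apply: le_trans (wnorm_sum _ (fun i => Q`_i * G ^+ i) r20) _.
    apply: ler_sum => j _; apply: le_trans (wnormM _ _ r20) _.
    rewrite ler_wpM2l ?wnorm_ge0 //; apply: le_trans (wnormX _ _ r20) _.
    by rewrite lerXn2r // nnegrE ?wnorm_ge0 ?mulr_ge0.
  have H1 : wnorm r%:R H <= 1.
    have H0 i : (i < M)%N -> H`_i = 0.
      move=> lt_iM; rewrite (@coef_horner_fps _ _ g _ i) ?Qg // => k le_ki.
      by rewrite fps_truncE // (leq_ltn_trans le_ki).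
    have p2 : 0 < 2 ^+ M :> C by rewrite exprn_gt0 ?ltr0n.
    rewrite -(ler_pM2l p2) mulr1; apply: le_trans (wnorm_double r0 H0) _.
    apply: le_trans HK _; apply: le_trans KN _; rewrite -natrX ler_nat.
    by apply: leq_trans (leq_addr m.+1 N) _; rewrite ltnW // ltn_expl.
  have -> : g m = G`_m by rewrite fps_truncE // /M addnS ltnS leq_addl.
  apply: coef_cauchy => // t tr.
  have HE : \sum_(j < n) (Q`_j).[t] * G.[t] ^+ j + G.[t] ^+ n = H.[t].
    rewrite /H (horner_coef Q) szQ big_ord_recr /= hornerD horner_sum; congr (_ + _).
      by apply: eq_bigr => j _; rewrite hornerM horner_exp.
    by have := monicP monQ; rewrite lead_coefE -/n => ->; rewrite mul1r horner_exp.
  apply: le_trans (monic_root_bound n_gt0 _ HE) _.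
    by apply: le_trans (horner_le_wnorm _ _) _; rewrite tr.
  have re1 : 1 <= r%:R ^+ e :> C by rewrite exprn_ege1.
  rewrite /Bc mulrDl mul1r; apply: lerD => //; rewrite mulr_suml; apply: ler_sum => j _.
  apply: le_trans (horner_le_wnorm _ _) _; rewrite tr !(wnorm_wide _ (leqnn _)) mulr_suml.
  apply: ler_sum => i _; rewrite expr1n mulr1 ler_wpM2l // ler_weXn2l //.
  by apply: leq_trans (ltnW (ltn_ord i)) _; apply: (leq_bigmax (F := fun j : 'I_n => size (Q`_j)%R)).
exists (fps_trunc e.+1 g); apply/funext => m.
rewrite /fps_of_poly coef_poly; case: ltnP => // lt_em.
apply/eqP; rewrite -normr_eq0; apply: contraT => gm0.
have gm_gt0 : 0 < `|g m| by rewrite lt_def gm0 normr_ge0.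
(* At radius [N.+1] the bound [key] contradicts the choice of [N]. *)
have [N NB] := archi (Bc / `|g m|).
have Bc0 : 0 <= Bc by rewrite addr_ge0 // sumr_ge0 // => j _; rewrite wnorm_ge0.
have N0 : 0 < N.+1%:R :> C by rewrite ltr0n.
have lt_Bc : Bc < `|g m| * N.+1%:R.
  rewrite -ltr_pdivrMl // mulrC; apply: le_lt_trans (_ : N%:R < _); last by rewrite ltr_nat.
  by apply: le_trans NB; rewrite (ger0_norm (divr_ge0 Bc0 (normr_ge0 _))).
have le_Bc : `|g m| * N.+1%:R ^+ (m - e) <= Bc.
  rewrite -(ler_pM2r (exprn_gt0 e N0)) -mulrA -exprD subnK ?(ltnW lt_em) //.
  exact: key.
suff : Bc < Bc by rewrite ltxx.
apply: lt_le_trans lt_Bc (le_trans _ le_Bc); rewrite ler_wpM2l //.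
by rewrite -[leLHS]expr1 ler_weXn2l ?ler1n ?subn_gt0.
Qed.

End AlgebraicEntire.

(** * Expansions of an algebraic function *)

Lemma horner_taylor1 (A : comNzRingType) (Q : {poly A}) (x h : A) :
  exists s, Q.[x + h] = Q.[x] + Q^`().[x] * h + h ^+ 2 * s.
Proof.
elim/poly_ind: Q => [|Q c [s IHQ]]; first by exists 0; rewrite deriv0 !horner0; ring.
exists (Q^`().[x] + s * (x + h)); rewrite derivMXaddC !(hornerMXaddC, hornerD, hornerMX) IHQ.
by ring.
Qed.

Lemma horner2_const (A : comNzRingType) (Q : {poly {poly A}}) (G : {poly A}) x :
  Q.[G].[x] = Q.[G.[x]%:P].[x].
Proof.
elim/poly_ind: Q => [|Q c IHQ]; first by rewrite !horner0.
by rewrite !hornerMXaddC !hornerD !hornerM IHQ hornerC.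
Qed.

(** One coefficient at a time: a new term of degree [n.+1] in [G n] changes the coefficient of that
    index in [P.[G n]] by [b] times its own coefficient, which can thus be chosen to cancel it. *)
Lemma hensel (K : fieldType) (P : {poly {poly K}}) (c : K) :
    P.[c%:P].[0] = 0 -> P^`().[c%:P].[0] != 0 ->
  exists u : fps K, u 0%N = c /\ (map_poly (@fps_of_poly K) P).[u] = 0.
Proof.
move=> Pc0 dPc0; set b := P^`().[c%:P].[0] in dPc0.
pose step n (G : {poly K}) := G + (- (P.[G])`_n.+1 / b) *: 'X^(n.+1).
pose fix G n := if n is n'.+1 then step n' (G n') else c%:P.
have coefG n i : (i <= n)%N -> (G n.+1)`_i = (G n)`_i.
  move=> le_in; rewrite /= /step coefD coefZ coefXn.
  by rewrite (_ : i == _ = false) ?mulr0 ?addr0 //; apply/eqP => iE; rewrite iE ltnn in le_in.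
have coefGi n i : (i <= n)%N -> (G n)`_i = (G i)`_i.
  elim: n => [|n IHn]; first by rewrite leqn0 => /eqP ->.
  by rewrite leq_eqVlt => /predU1P[->//|lt_in]; rewrite coefG ?IHn.
have PG n i : (i <= n)%N -> (P.[G n])`_i = 0.
  elim: n i => [|n IHn] i.
    by rewrite leqn0 => /eqP ->; rewrite -horner_coef0.
  have [s sE] := horner_taylor1 P (G n) ((- (P.[G n])`_n.+1 / b) *: 'X^(n.+1)).
  rewrite /= /step sE -scalerAr exprZn -scalerAl !coefD !coefZ coefMXn -exprM coefXnM => le_in.
  (* The quadratic remainder starts at index [n.+1 * 2], beyond the indices considered. *)
  have -> : (i < n.+1 * 2)%N by lia.
  rewrite mulr0 addr0.
  move: le_in; rewrite leq_eqVlt => /predU1P[->|lt_in]; last first.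
    by rewrite lt_in mulr0 addr0 IHn // -ltnS.
  rewrite ltnn subnn -[(P^`().[_])`_0]horner_coef0 horner2_const.
  by rewrite [(G n).[0]]horner_coef0 coefGi // coefC /= -/b mulfVK ?subrr // subrr.
exists (fun n => (G n)`_n); split; first by rewrite coefC.
by apply/funext => n; rewrite -(@coef_horner_fps _ _ _ (G n) n) ?PG // => i; apply: coefGi.
Qed.

(** * Taylor expansions of polynomials at a moving centre *)

Section Taylor.
Variable K : comNzRingType.
Implicit Types (a b : K) (p q : {poly K}) (Q : {poly {poly K}}).

(** Through this morphism polynomials in the global variable [z] act on series in [t = z - a], so
    equations stay written in [z] whatever the centre. *)
Definition taylor a p : fps K := fps_of_poly (p \Po ('X + a%:P)).

Fact taylor_is_zmod_morphism a : zmod_morphism (taylor a).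
Proof. by move=> p q; rewrite /taylor rmorphB rmorphB. Qed.

Fact taylor_is_monoid_morphism a : monoid_morphism (taylor a).
Proof. by split=> [|p q]; rewrite /taylor ?rmorph1 // !rmorphM. Qed.

HB.instance Definition _ a := GRing.isZmodMorphism.Build {poly K} (fps K)
  (taylor a) (taylor_is_zmod_morphism a).
HB.instance Definition _ a := GRing.isMonoidMorphism.Build {poly K} (fps K)
  (taylor a) (taylor_is_monoid_morphism a).

Lemma taylor_const0 a p : taylor a p 0%N = p.[a].
Proof. by rewrite /taylor /fps_of_poly -horner_coef0 horner_comp !hornerE. Qed.

Lemma taylor_deriv a p : fps_deriv (taylor a p) = taylor a p^`().
Proof. by rewrite fps_deriv_of_poly deriv_comp derivD derivX derivC addr0 mulr1. Qed.

Lemma taylor_shift a b p : taylor a (p \Po ('X + b%:P)) = taylor (a + b) p.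
Proof.
rewrite /taylor -comp_polyA; congr (fps_of_poly (p \Po _)).
by rewrite comp_polyD comp_polyX comp_polyC polyCD addrA.
Qed.

Lemma fps_of_polyE a p : fps_of_poly p = taylor a (p \Po ('X - a%:P)).
Proof.
rewrite /taylor -comp_polyA comp_polyB comp_polyX comp_polyC addrK.
by rewrite comp_polyXr.
Qed.

Lemma taylor_eq0 a p : taylor a p = 0 -> p = 0.
Proof.
move=> p0; have : p \Po ('X + a%:P) = 0.
  by apply/polyP => i; rewrite coef0 -[RHS]/((0 : fps K) i) -p0.
by move=> /(congr1 (fun q => q \Po ('X - a%:P))); rewrite comp_polyXaddC_K comp_poly0.
Qed.

Lemma map_taylor a Q :
  map_poly (taylor a) Q = map_poly (@fps_of_poly K) (map_poly (comp_poly ('X + a%:P)) Q).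
Proof. by rewrite -map_poly_comp. Qed.

Lemma map_taylor_shift a b Q :
  map_poly (taylor (a + b)) Q = map_poly (taylor a) (map_poly (comp_poly ('X + b%:P)) Q).
Proof.
by apply/polyP => i; rewrite !coef_map /= taylor_shift.
Qed.

Lemma horner_map_shift a Q (c : K) :
  (map_poly (comp_poly ('X + a%:P)) Q).[c%:P].[0] = Q.[c%:P].[a].
Proof.
rewrite -[c%:P in LHS](comp_polyC c ('X + a%:P)) horner_map horner_comp.
by rewrite !hornerE.
Qed.

(** All integer centres at once: an equation over [{poly K}] satisfied in this product ring is one
    equation, independent of [n], valid at every centre. *)
Definition taylor_nat p : nat -> fps K := fun n => taylor n%:R p.

Fact taylor_nat_is_zmod_morphism : zmod_morphism taylor_nat.
Proof. by move=> p q; apply/funext => n; rewrite /taylor_nat rmorphB. Qed.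

Fact taylor_nat_is_monoid_morphism : monoid_morphism taylor_nat.
Proof.
by split=> [|p q]; apply/funext => n; rewrite /taylor_nat ?rmorph1 ?rmorphM.
Qed.

HB.instance Definition _ := GRing.isZmodMorphism.Build {poly K} (nat -> fps K)
  taylor_nat taylor_nat_is_zmod_morphism.
HB.instance Definition _ := GRing.isMonoidMorphism.Build {poly K} (nat -> fps K)
  taylor_nat taylor_nat_is_monoid_morphism.

Lemma horner_taylor_nat Q (x : nat -> fps K) n :
  (map_poly taylor_nat Q).[x] n = (map_poly (taylor n%:R) Q).[x n].
Proof.
elim/poly_ind: Q => [|Q c IHQ]; first by rewrite !rmorph0 !horner0.
by rewrite !rmorphD !rmorphM /= !map_polyX !map_polyC !hornerMXaddC -IHQ.
Qed.

End Taylor.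

Lemma hensel_taylor (K : fieldType) (P : {poly {poly K}}) (a c : K) :
    P.[c%:P].[a] = 0 -> P^`().[c%:P].[a] != 0 ->
  exists u : fps K, u 0%N = c /\ (map_poly (taylor a) P).[u] = 0.
Proof.
move=> Pc dPc; rewrite map_taylor; apply: hensel; rewrite ?horner_map_shift //.
by rewrite deriv_map horner_map_shift.
Qed.

(** Multiplying the equation by a power of the leading coefficient [l] turns it into a monic
    equation for [l x]. *)
Lemma integral_lead_coef (B : comNzRingType) (A : comNzRingType) (tau : {rmorphism B -> A})
    (Q : {poly B}) x : (map_poly tau Q).[x] = 0 -> integralOver tau (tau (lead_coef Q) * x).
Proof.
move=> Qx; pose s := (size Q).-1; have lcE : lead_coef Q = Q`_s by [].
have szQ : (size Q <= s.+1)%N by rewrite /s; case: (size Q).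
have QxE : \sum_(i < s) tau Q`_i * x ^+ i + tau (lead_coef Q) * x ^+ s = 0.
  rewrite -[RHS]Qx (@horner_coef_wide _ s.+1) ?(leq_trans (size_poly _ _)) //.
  rewrite big_ord_recr /= coef_map lcE; congr (_ + _).
  by apply: eq_bigr => i _; rewrite coef_map.
case: s QxE {szQ lcE} => [|s] QxE.
  move: QxE; rewrite big_ord0 add0r expr0 mulr1 => ->; rewrite mul0r.
  exact: mxpoly.integral0.
set l := lead_coef Q in QxE *.
pose M := \poly_(i < s.+1) (Q`_i * l ^+ (s - i)).
exists ('X^(s.+1) + M).
  by rewrite monicE lead_coefDl ?lead_coefXn // size_polyXn ltnS size_poly.
rewrite /root rmorphD /= map_polyXn hornerD hornerXn.
rewrite (@horner_coef_wide _ s.+1) ?(leq_trans (size_poly _ _)) ?size_poly //.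
apply/eqP; transitivity (tau l ^+ s * 0); last by rewrite mulr0.
rewrite -[X in _ = _ * X]QxE mulrDr addrC mulr_sumr; congr (_ + _); last first.
  by rewrite exprMn exprSr -mulrA.
apply: eq_bigr => i _; rewrite coef_map coef_poly ltn_ord /= rmorphM rmorphXn exprMn.
have -> : tau l ^+ s = tau l ^+ (s - i) * tau l ^+ i by rewrite -exprD subnK // -ltnS.
by move: (_ ^+ (s - i)) (tau l ^+ i) (x ^+ i) => ? ? ?; rewrite /=; ring.
Qed.

Lemma nat_notin_seq (K : numFieldType) (s : seq K) : exists N, forall n, (N <= n)%N -> n%:R \notin s.
Proof.
elim: s => [|x s [N NP]]; first by exists 0%N.
have [[m mx]|nx] := pselect (exists m : nat, m%:R = x).
  exists (maxn N m.+1) => n; rewrite geq_max inE negb_or => /andP[/NP -> lt_mn].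
  by rewrite -mx eqr_nat andbT; apply: contraTneq lt_mn => ->; rewrite ltnn.
exists N => n /NP ns; rewrite inE negb_or ns andbT; apply/eqP => nE.
by apply: nx; exists n.
Qed.

Lemma poly_nat_nonroot (K : numClosedFieldType) (p : {poly K}) : p != 0 ->
  exists N, forall n, (N <= n)%N -> p.[n%:R] != 0.
Proof.
move=> p0; have [rs pE] := closed_field_poly_normal p.
have [N NP] := nat_notin_seq rs; exists N => n /NP; apply: contraNN => pn.
rewrite -root_prod_XsubC -(@rootZ _ _ (lead_coef p)) ?lead_coef_eq0 //.
by rewrite -pE.
Qed.

Lemma shift_eq0 (K : comNzRingType) (p : {poly K}) a : (p \Po ('X + a%:P) == 0) = (p == 0).
Proof.
apply/eqP/eqP => [p0|->]; last exact: comp_poly0.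
by rewrite -(comp_polyXaddC_K p a) p0 comp_poly0.
Qed.

Lemma lead_coef_map_shift (K : idomainType) a (P : {poly {poly K}}) :
  lead_coef (map_poly (comp_poly ('X + a%:P)) P) = lead_coef P \Po ('X + a%:P).
Proof.
have [->|P0] := eqVneq P 0; first by rewrite rmorph0 !lead_coef0 comp_poly0.
by rewrite lead_coef_map_eq // shift_eq0 lead_coef_eq0.
Qed.

(** * Recurrences between expansions *)

Section Holonomic.
Variable C : numClosedFieldType.
Hypothesis archi : forall x : C, exists n : nat, `|x| <= n%:R.
Implicit Types (p q : {poly C}) (P : {poly {poly C}}) (a : nat -> C).

Local Notation T := (@taylor_nat C).
Local Notation shift i := (comp_poly ('X + i%:R%:P)).

(* Expanding at all integers at once, in the ring [nat -> fps C], gives one monic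
   [H = X^e H1] with root [E h], valid at every [n].  For large [n] the series
   [E h] has constant term [0] while that of [H1(0)] is not [0], so [H1(E h)] is
   regular and [E h = 0]. *)
Lemma recurrence_lift P (a : nat -> C) (F : nat -> fps C) d (p : nat -> {poly C}) N0 :
    P != 0 ->
    (forall n, (N0 <= n)%N -> F n 0%N = a n /\ (map_poly (taylor n%:R) P).[F n] = 0) ->
    (forall n, (N0 <= n)%N -> \sum_(k < d) (p k).[n%:R] * a (n + k)%N = 0) ->
  exists N, forall n, (N <= n)%N -> \sum_(k < d) taylor n%:R (p k) * F (n + k)%N = 0.
Proof.
move=> P0 FP rec.
pose lc k := lead_coef P \Po ('X + k%:R%:P).
(* Below [N0] nothing is known of [F], so the value is set to 0 there; the factor ['X] put on the
   equation below adds the root 0 and keeps the leading coefficient. *)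
pose Phi k : nat -> fps C := fun n => if (N0 <= n)%N then F (n + k)%N else 0.
have lc0 k : lc k != 0 by rewrite shift_eq0 lead_coef_eq0.
have intPhi k : integralOver T (T (lc k) * Phi k).
  have -> : lc k = lead_coef (map_poly (shift k) P * 'X).
    by rewrite lead_coefM lead_coefX mulr1 lead_coef_map_shift.
  apply: integral_lead_coef; apply/funext => n; rewrite horner_taylor_nat.
  rewrite rmorphM /= map_polyX hornerMX /Phi; case: leqP => [le_Nn|_]; last by rewrite mulr0.
  rewrite -map_taylor_shift -natrD.
  by have [_ ->] := FP (n + k)%N (leq_trans le_Nn (leq_addr _ _)); rewrite mul0r.
pose E := \prod_(k < d) lc k.
have E0 : E != 0 by apply/prodf_neq0 => k _.
pose h : nat -> fps C := \sum_(k < d) T (p k) * Phi k.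
have [H monH Hh] : integralOver T (T E * h).
  rewrite mulr_sumr; apply: (big_ind (integralOver T)); first exact: mxpoly.integral0.
    by move=> x y; apply: integral_add.
  move=> k _.
  rewrite (_ : _ * _ = T (p k * \prod_(i < d | i != k) lc i) * (T (lc k) * Phi k)).
    by apply: integral_mul => //; apply: integral_id.
  by rewrite /E (bigD1 k) //= !rmorphM; ring.
have [e [H1 H10 HE]] := multiplicity_XsubC H 0.
rewrite monic_neq0 //= in H10; rewrite subr0 in HE.
set c0 := H1.[0] in H10.
have [N NP] : exists N, forall n, (N <= n)%N -> (c0 * E).[n%:R] != 0.
  by apply: poly_nat_nonroot; rewrite mulf_neq0.
exists (maxn N N0) => n; rewrite geq_max => /andP[/NP].
rewrite hornerM mulf_eq0 negb_or => /andP[c0n En] le_N0n.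
have hn : h n = \sum_(k < d) taylor n%:R (p k) * F (n + k)%N.
  rewrite /h fct_sumE; apply: eq_bigr => k _.
  by rewrite /Phi; rewrite [LHS]/(_ * _) /= le_N0n.
rewrite -hn; set y := (T E * h) n.
(* The constant term of [y] is a multiple of the numerical recurrence at [n]. *)
have y0 : y 0%N = 0.
  have -> : y 0%N = E.[n%:R] * (h n) 0%N by rewrite -taylor_const0; apply: (rmorphM (@fps_const0 C)).
  rewrite hn fps_sum (eq_bigr (fun k : 'I_d => (p k).[n%:R] * a (n + k)%N)) ?rec ?mulr0 // => k _.
  have [<- _] := FP (n + k)%N (leq_trans le_N0n (leq_addr _ _)).
  by rewrite -taylor_const0; apply: (rmorphM (@fps_const0 C)).
have Hy : (map_poly (taylor n%:R) H).[y] = 0.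
  by rewrite /y -horner_taylor_nat (rootP Hh).
move: Hy; rewrite HE rmorphM rmorphXn /= map_polyX hornerM horner_exp hornerX.
move=> /fps_mul_eq0[H1y|].
  case/eqP: c0n; rewrite -taylor_const0 -[RHS]/((0 : fps C) 0%N) -H1y.
  rewrite -[RHS]/(@fps_const0 C _) -[RHS]horner_map -map_poly_comp /= [fps_const0 y]y0.
  by rewrite horner_coef0 coef_map /c0 horner_coef0.
move=> ye; have {ye} : y = 0.
  elim: e {HE} ye => [|e IHe]; last by rewrite exprS => /fps_mul_eq0[].
  by move=> /eqP; rewrite expr0 oner_eq0.
move=> /fps_mul_eq0[/taylor_eq0 E_0|//].
by rewrite E_0 eqxx in E0.
Qed.

End Holonomic.

(** * Elimination in the recurrence and rationality of an expansion *)

Section HolonomicRational.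
Variable C : numClosedFieldType.
Hypothesis archi : forall x : C, exists n : nat, `|x| <= n%:R.
Implicit Types (p q : {poly C}) (P : {poly {poly C}}) (a : nat -> C).
Local Notation shift i := (comp_poly ('X + i%:R%:P)).

(** The window of terms moves one step to the right: after multiplication by the shifted [p 0], its
    first term is replaced through the recurrence shifted by [j.+1]. *)
Lemma recurrence_skip (F : nat -> fps C) d (p : nat -> {poly C}) N : p 0%N != 0 ->
    (forall n, (N <= n)%N -> \sum_(k < d.+2) taylor n%:R (p k) * F (n + k)%N = 0) ->
  forall j, exists q (r : nat -> {poly C}), q != 0 /\ forall n, (N <= n)%N ->
    taylor n%:R q * F n = \sum_(k < d.+1) taylor n%:R (r k) * F (n + (j.+1 + k))%N.
Proof.
move=> p0 rec; elim=> [|j [q [r [q0 qF]]]].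
  exists (p 0%N), (fun k => - p k.+1); split=> // n /rec.
  rewrite big_ord_recl /= addn0 => /eqP; rewrite addr_eq0 => /eqP ->.
  by rewrite -sumrN; apply: eq_bigr => k _; rewrite rmorphN mulNr.
pose s (u : {poly C}) := u \Po ('X + j.+1%:R%:P).
exists (q * s (p 0%N)).
(* The last position of the new window has no old term, hence the default 0. *)
exists (fun k => (if (k < d)%N then r k.+1 * s (p 0%N) else 0) - r 0%N * s (p k.+1)).
split=> [|n le_Nn]; first by rewrite mulf_neq0 // shift_eq0.
rewrite rmorphM mulrAC qF // big_ord_recl /= addn0.
have sE k : taylor n%:R (s (p k)) = taylor (n + j.+1)%:R (p k).
  by rewrite /s /= taylor_shift natrD.
have := rec (n + j.+1)%N (leq_trans le_Nn (leq_addr _ _)).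
rewrite big_ord_recl /= addn0 -sE => /eqP; rewrite addr_eq0 => /eqP pF.
rewrite mulrDl mulrAC -mulrA pF.
under [in RHS]eq_bigr do rewrite rmorphB mulrBl.
rewrite sumrB addrC; congr (_ + _); last first.
  rewrite mulrN mulr_sumr; congr (- _); apply: eq_bigr => k _.
  by rewrite rmorphM /= sE -mulrA; congr (_ * (_ * F _)); rewrite /bump /=; lia.
rewrite big_ord_recr /= ltnn rmorph0 mul0r addr0 mulr_suml; apply: eq_bigr => k _.
rewrite ltn_ord rmorphM /= mulrAC; congr (_ * F _); rewrite /bump /=; lia.
Qed.

(** A common root makes [i] a difference of two roots of [D], and there are finitely many of
    these. *)
Lemma shift_coprime (D : {poly C}) : D != 0 -> exists j, forall i, (j <= i)%N ->
  coprimep D (D \Po ('X + i%:R%:P)).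
Proof.
move=> D0; have [rs DE] := closed_field_poly_normal D.
have rootD x : root D x -> x \in rs.
  by rewrite DE rootZ ?lead_coef_eq0 // root_prod_XsubC.
have [j jP] := nat_notin_seq [seq y - x | x <- rs, y <- rs].
exists j => i /jP; apply: contraNT => nco.
have [x [Dx Dxi]] : exists x, root D x /\ root D (x + i%:R).
  apply: contrapT => nx; move/negP: nco; apply; apply: Pdiv.ClosedField.root_coprimep => x Dx.
  apply: contra_notN nx => /eqP Dxi; exists x; split=> //; rewrite /root -Dxi.
  by rewrite horner_comp !hornerE.
by apply/allpairsP; exists (x, x + i%:R); rewrite /= !rootD // addrC addKr.
Qed.

(** By noetherianity some derivative is a combination of earlier ones: a monic differential
    equation, whose solution [g] converges everywhere. Integrality then makes [g] a polynomial.
    Composing with ['X + a] passes to the local variable. *)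
Lemma poly_of_finite_derivatives (a : C) w g :
    (forall m, polyspan (taylor a) w (iter m (@fps_deriv C) g)) ->
    integralOver (taylor a) g ->
  exists p, g = taylor a p.
Proof.
move=> gw [Q monQ /rootP Qg].
have [n [c cE]] := polyspan_noetherian gw.
have [p ->] : exists p, g = fps_of_poly p.
  apply: (@algebraic_entire_is_poly _ archi _ (map_poly (comp_poly ('X + a%:P)) Q)).
  - exact: monic_map.
  - by rewrite -map_taylor.
  - exact: (entire_of_monic_ode archi (r := fun j => c j \Po ('X + a%:P)) cE).
by exists (p \Po ('X - a%:P)); rewrite -fps_of_polyE.
Qed.

(** The conclusion gives the value at one large [n] only, where [D0] is nonzero and the value
    therefore selects one branch of the equation, together with the fact that the fraction is a
    solution. Spreading the equality over the domain is left to topology. *)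
Lemma holonomic_algebraic_rational P D0 (a : nat -> C) d (p : nat -> {poly C}) N :
    P != 0 -> D0 != 0 -> (exists U V, U * P + V * P^`() = D0%:P) ->
    (forall n, (N <= n)%N -> P.[(a n)%:P].[n%:R] = 0) ->
    p 0%N != 0 ->
    (forall n, (N <= n)%N -> \sum_(k < d.+2) (p k).[n%:R] * a (n + k)%N = 0) ->
  exists p' q' n, [/\ (N <= n)%N, D0.[n%:R] != 0, q'.[n%:R] != 0,
    q'.[n%:R] * a n = p'.[n%:R] &
    forall z, q'.[z] != 0 -> P.[(p'.[z] / q'.[z])%:P].[z] = 0].
Proof.
move=> P0 D00 [U [V UVD]] Pa p0 rec.
have [ND NDP] := poly_nat_nonroot D00.
(* Where [D0] is nonzero the Bezout relation excludes a multiple root, so [a n] lifts to a series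
   solution. *)
have exF n : exists u : fps C, (maxn N ND <= n)%N ->
    u 0%N = a n /\ (map_poly (taylor n%:R) P).[u] = 0.
  have [|_] := leqP (maxn N ND) n; last by exists 0.
  rewrite geq_max => /andP[le_Nn /NDP Dn].
  have [||u uP] := @hensel_taylor _ P n%:R (a n); [exact: Pa | | by exists u].
  apply: contraNneq Dn => dPn; have /(congr1 (fun Q : {poly {poly C}} => Q.[(a n)%:P].[n%:R])) := UVD.
  by rewrite !(hornerD, hornerM) dPn Pa // !mulr0 addr0 hornerC => <-.
have [F FP] := choice exF.
have [|N1 recF] := @recurrence_lift _ P a F d.+2 p (maxn N ND) P0 FP.
  by move=> n; rewrite geq_max => /andP[/rec].
pose D := D0 * lead_coef P.
have D_neq0 : D != 0 by rewrite mulf_neq0 ?lead_coef_eq0.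
have [j jP] := shift_coprime D_neq0.
have [q [r [q0 qF]]] := recurrence_skip p0 recF j.
(* [q] comes from the elimination; the leading coefficient makes the multiple of [F n] integral. *)
pose q' := lead_coef P * q.
have [N2 q'P] : exists N2, forall n, (N2 <= n)%N -> q'.[n%:R] != 0.
  by apply: poly_nat_nonroot; rewrite mulf_neq0 ?lead_coef_eq0.
pose n := maxn (maxn N ND) (maxn N1 N2).
have [le_Nn le_NDn le_N1n le_N2n] : [/\ (N <= n)%N, (ND <= n)%N, (N1 <= n)%N & (N2 <= n)%N].
  by rewrite /n !leq_max !leqnn !orbT.
have FnP i : F (n + i)%N 0%N = a (n + i)%N /\ (map_poly (taylor (n + i)%:R) P).[F (n + i)%N] = 0.
  by apply: FP; rewrite geq_max !(leq_trans _ (leq_addr i n)).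
pose t := @taylor C n%:R; pose der := @fps_deriv C.
(* Written at centre [n], the equation of [F (n + i)] is [P] translated by [i], so its denominators
   are powers of the translate of [D]. *)
have bF i : exists w, bounded_denom (taylor n%:R) (@fps_deriv C) (D \Po ('X + i%:R%:P)) w (F (n + i)%N).
  have [_] := FnP i; rewrite natrD map_taylor_shift => /bounded_denom_root.
  move=> /(_ _ (@fps_derivM _) (@taylor_deriv _ _) (D0 \Po ('X + i%:R%:P))).
  rewrite lead_coef_map_shift -comp_polyM; apply.
    by rewrite map_poly_eq0_id0 // shift_eq0 lead_coef_eq0.
  exists (map_poly (shift i) U), (map_poly (shift i) V).
  by rewrite deriv_map -!rmorphM -rmorphD UVD /= map_polyC.
have [w1 b1] : exists w, bounded_denom (taylor n%:R) (@fps_deriv C) D w (taylor n%:R q' * F n).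
  have [w] := bF 0%N; rewrite addn0 addr0 comp_polyXr => bw; exists w.
  by apply: bounded_denomZ bw; [exact: fps_derivM | exact: taylor_deriv].
have [w2 b2] : exists w, bounded_denom (taylor n%:R) (@fps_deriv C)
    (\prod_(k < d.+1) (D \Po ('X + (j.+1 + k)%:R%:P))) w (taylor n%:R q' * F n).
  have [|w bw] := bounded_denom_sum (@fps_derivM _) (@taylor_deriv _ n%:R) (n := d.+1)
    (E := fun k => D \Po ('X + (j.+1 + k)%:R%:P)) r (x := fun k => F (n + (j.+1 + k))%N).
    by move=> k _; apply: bF.
  exists w; rewrite /q' rmorphM -mulrA qF //.
  by apply: bounded_denomZ bw; [exact: fps_derivM | exact: taylor_deriv].
(* The two descriptions of [q' F n], directly and through the distant window, have coprime
   denominators. *)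
have co : coprimep D (\prod_(k < d.+1) (D \Po ('X + (j.+1 + k)%:R%:P))).
  apply: (big_ind (coprimep D)); first exact: coprimep1.
    by move=> x y Dx Dy; rewrite coprimepMr Dx.
  by move=> k _; apply: jP; rewrite addSn leqW // leq_addr.
have [Fn0 FnQ] := FnP 0%N; rewrite addn0 in Fn0 FnQ.
have [p' gE] : exists p', taylor n%:R q' * F n = taylor n%:R p'.
  apply: poly_of_finite_derivatives (bounded_denom_coprime co b1 b2) _.
  rewrite /q' mulrC rmorphM mulrA; apply: integral_mul; last exact: integral_id.
  by rewrite mulrC; apply: integral_lead_coef.
exists p', q', n; split=> //.
- exact: NDP.
- exact: q'P.
- by rewrite -!taylor_const0 -Fn0 -gE; apply/esym/(rmorphM (@fps_const0 C)).
clearbody q' => z q'z; pose s := size P.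
(* [S] is [P] at [p' / q'] with denominators cleared; its expansion at [n] is a multiple of the
   value of [P] at [F n], which is 0. *)
pose S := \sum_(i < s) P`_i * p' ^+ i * q' ^+ (s - i).
have S0 : S = 0.
  apply: (@taylor_eq0 _ n%:R); transitivity (taylor n%:R q' ^+ s * (map_poly (taylor n%:R) P).[F n]).
    rewrite (@horner_coef_wide _ s) ?size_poly // mulr_sumr rmorph_sum; apply: eq_bigr => i _.
    rewrite coef_map /= !rmorphM !rmorphXn /= -gE exprMn.
    have -> : taylor n%:R q' ^+ s = taylor n%:R q' ^+ (s - i) * taylor n%:R q' ^+ i.
      by rewrite -exprD subnK // ltnW.
    move: (_ ^+ (s - i)) (taylor _ q' ^+ i) (F n ^+ i) => x y u; rewrite /=; ring.
  by rewrite FnQ mulr0.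
have : q'.[z] ^+ s * P.[(p'.[z] / q'.[z])%:P].[z] = 0.
  rewrite -[RHS](horner0 z) -S0 /S horner_sum (horner_coef P) horner_sum mulr_sumr; apply: eq_bigr => i _.
  rewrite -polyC_exp !hornerM !horner_exp hornerC expr_div_n.
  have -> : q'.[z] ^+ s = q'.[z] ^+ (s - i) * q'.[z] ^+ i by rewrite -exprD subnK // ltnW.
  have : q'.[z] ^+ i != 0 by rewrite expf_neq0.
  by move: (_ ^+ (s - i)) (q'.[z] ^+ i) (_ ^+ i) => x y u y0; field.
by move=> /eqP; rewrite mulf_eq0 expf_eq0 (negPf q'z) andbF => /eqP.
Qed.

End HolonomicRational.

(** * Separable equations and normalized recurrences *)

Lemma horner_eval_map (K : comNzRingType) (P : {poly {poly K}}) (z w : K) :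
  (map_poly (horner_eval z) P).[w] = P.[w%:P].[z].
Proof. by rewrite -[w in LHS](hornerC w z) -[_.[z] in LHS]/(horner_eval z _) horner_map. Qed.

(** Dividing by the gcd with the derivative loses no root: if [h] missed a root [w] of order [e.+1],
    that full power would divide [g], hence the derivative of [p], whose order at [w] is exactly [e]
    in characteristic 0. *)
Lemma root_quotient_gcd_deriv (K : numFieldType) (p h g k : {poly K}) (c c' w : K) :
    p != 0 -> c != 0 -> c' != 0 -> c *: p = h * g -> c' *: p^`() = k * g ->
  root p w -> root h w.
Proof.
move=> p0 c0 c'0 pE p'E pw; apply: contraT => hw.
have [e [s]] := multiplicity_XsubC p w; rewrite p0 /= => sw pE'.
case: e pE' => [|e] pE'; first by rewrite pE' mulr1 (negPf sw) in pw.
have dvd_g : ('X - w%:P) ^+ e.+1 %| g.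
  rewrite -(@Pdiv.Field.Gauss_dvdpr _ g h) //.
    by rewrite -pE dvdpZr // pE' dvdp_mulIr.
  by apply: coprimep_expl; rewrite coprimep_sym coprimep_XsubC.
have : ('X - w%:P) ^+ e.+1 %| p^`().
  by rewrite -(dvdpZr _ _ c'0) p'E dvdp_mull.
rewrite pE' derivM dvdp_addr; last exact: dvdp_mull.
rewrite deriv_exp derivXsubC mul1r /=.
rewrite mulrnAr -mulrnAl mulrC exprSr -[_ *+ _]scaler_nat.
rewrite dvdp_mul2l ?expf_neq0 ?polyXsubC_eq0 // dvdpZr ?pnatr_eq0 // dvdp_XsubCl.
by rewrite (negPf sw).
Qed.

(** [H] is the squarefree part of [P] in the variable [w]; it is coprime to its derivative, and the
    Bezout relation cleared of denominators gives [D0]. *)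
Lemma separable_annihilator (K : numFieldType) (P : {poly {poly K}}) : P != 0 ->
  exists P1 D0, [/\ P1 != 0, D0 != 0, exists U V, U * P1 + V * P1^`() = D0%:P &
    forall z w, P.[w%:P].[z] = 0 -> P1.[w%:P].[z] = 0].
Proof.
move=> P0; set g := gcdp P P^`(); pose H := P %/ g.
have sepH : separable_poly H := make_separable P0.
have H0 : H != 0 := separable_poly_neq0 sepH.
pose c := lead_coef g ^+ scalp P g.
have c0 : c != 0 := Pdiv.Idomain.lc_expn_scalp_neq0 _ _.
have PE : c *: P = H * g by rewrite /H Pdiv.Idomain.divpK ?dvdp_gcdl.
have [[c' k] /= c'0 dPE] := Pdiv.Idomain.dvdpP _ _ (dvdp_gcdr P P^`()).
move: sepH; rewrite unlock => /Pdiv.Idomain.Bezout_coprimepP[[U V]].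
move=> /Pdiv.Idomain.eqpP[[c1 c2] /= /andP[c10 c20] UVE].
(* [E] vanishes at the exceptional [z], where the divisions may fail to specialize; after
   multiplication by [E] the equation holds there for every [w]. *)
pose E := c * c' * lead_coef P.
have E0 : E != 0 by rewrite !mulf_neq0 ?lead_coef_eq0.
exists (E *: H), (E * c2); split.
- by rewrite scale_poly_eq0 negb_or E0.
- by rewrite mulf_neq0.
- exists (c1 *: U), (c1 *: V); rewrite derivZ -!scalerAl -!scalerAr -!scalerDr.
  by rewrite scalerA [c1 * E]mulrC -scalerA UVE scalerA -mul_polyC mulr1.
move=> z w Pzw; rewrite hornerZ hornerM.
have [->|Ez] := eqVneq E.[z] 0; first by rewrite mul0r.
move: Ez; rewrite /E !hornerM !mulf_eq0 !negb_or => /andP[/andP[cz c'z] lz].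
pose ev : {poly {poly K}} -> {poly K} := map_poly (horner_eval z).
have evZ x Q : ev (x *: Q) = x.[z] *: ev Q by rewrite /ev map_polyZ.
have evM Q1 Q2 : ev (Q1 * Q2) = ev Q1 * ev Q2 by rewrite /ev rmorphM.
suff : root (ev H) w by rewrite /root /ev horner_eval_map => /eqP ->; rewrite mulr0.
apply: (@root_quotient_gcd_deriv _ (ev P) _ (ev g) (ev k) c.[z] c'.[z]) => //.
- by rewrite -lead_coef_eq0 lead_coef_map_eq.
- by rewrite -evZ PE evM.
- by rewrite /ev deriv_map -evM -dPE evZ.
- by rewrite /root /ev horner_eval_map Pzw.
Qed.

(** The zero coefficients in front are dropped and the index is moved by the first nonzero position
    [k0], so that elimination of the first term is possible; zero coefficients pad the end. *)
Lemma holonomic_normal (C : numFieldType) (a : nat -> C) d (p : 'I_d.+1 -> {poly C}) :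
    (exists k, p k != 0) ->
    (forall n, (1 <= n)%N -> \sum_(k < d.+1) (p k).[n%:R] * a (n + k)%N = 0) ->
  exists d' (p' : nat -> {poly C}) N, p' 0%N != 0 /\
    forall n, (N <= n)%N -> \sum_(k < d'.+2) (p' k).[n%:R] * a (n + k)%N = 0.
Proof.
move=> [k1 pk1] rec.
pose q k : {poly C} := if insub k is Some i then p i else 0.
have qE (i : 'I_d.+1) : q i = p i by rewrite /q valK.
have q_out k : (d < k)%N -> q k = 0 by move=> lt_dk; rewrite /q insubF // ltnS leqNgt lt_dk.
have exk : exists k, q k != 0 by exists k1; rewrite qE.
have [k0 qk0 min_k0] := find_ex_minn exk.
exists d, (fun k => q (k0 + k)%N \Po ('X - k0%:R%:P)), k0.+1; split=> [|n lt_k0n].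
  by rewrite addn0 -polyCN shift_eq0.
have [m m1 nE] : exists2 m, (1 <= m)%N & n = (k0 + m)%N.
  by exists (n - k0)%N; rewrite ?subn_gt0 // subnKC // ltnW.
have := rec m m1; under eq_bigr do rewrite -qE.
have -> : \sum_(k < d.+1) (q k).[m%:R] * a (m + k)%N = \sum_(k < k0 + d.+2) (q k).[m%:R] * a (m + k)%N.
  have le_d : (d.+1 <= k0 + d.+2)%N by lia.
  rewrite (big_ord_widen _ (fun k => (q k).[m%:R] * a (m + k)%N) le_d) big_mkcond /=.
  by apply: eq_bigr => k _; case: ltnP => // le_dk; rewrite q_out // horner0 mul0r.
rewrite big_split_ord /= big1 ?add0r => [|k _]; last first.
  have [->|/min_k0] := eqVneq (q k) 0; first by rewrite horner0 mul0r.
  by rewrite leqNgt ltn_ord.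
move=> sum0; rewrite -[RHS]sum0; apply: eq_bigr => k _.
rewrite nE horner_comp !hornerE natrD addrAC subrr add0r.
by congr (_ * a _); rewrite (addnC k0).
Qed.

(** The recurrence is [p(n+1) q(n) a(n) = p(n) q(n+1) a(n+1)]. For [p = 0] both coefficients would
    vanish, hence the separate case. *)
Lemma rational_holonomic (R : realType) (a : nat -> R[i]) (p q : {poly R[i]}) :
    q != 0 -> (forall n, (1 <= n)%N -> q.[n%:R] != 0 /\ a n = p.[n%:R] / q.[n%:R]) ->
  holonomic a.
Proof.
move=> q0 aE; have [p0|p0] := eqVneq p 0.
  exists 0%N, (fun=> 1); split=> [|n n1]; first by exists ord0; apply: oner_neq0.
  by rewrite big_ord1 addn0 (aE n n1).2 p0 horner0 mul0r mulr0.
pose s := 'X + 1%:P : {poly R[i]}.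
exists 1%N, (fun k => if k == ord0 then (p \Po s) * q else - (p * (q \Po s))); split.
  by exists ord0; rewrite /= mulf_neq0 // shift_eq0.
move=> n n1; rewrite big_ord_recl big_ord1 /= addn0 /bump /= addn1.
have [qn ->] := aE n n1; have [] := aE n.+1 isT; rewrite -natr1 => qn1 ->.
rewrite hornerN !hornerM !horner_comp /s !(hornerD, hornerX, hornerC).
move: (q.[n%:R]) (q.[n%:R + 1]) qn qn1 => x y x0 y0; field.
by apply/andP.
Qed.

(** * Identity principle *)

Lemma connected_local (T : topologicalType) (A S : set T) : connected A ->
    (forall t, A t -> S t -> \forall y \near t, A y -> S y) ->
    (forall t, A t -> ~ S t -> \forall y \near t, A y -> ~ S y) ->
  forall t0, A t0 -> S t0 -> forall t, A t -> S t.
Proof.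
move=> conA openS openNS t0 At0 St0.
suff AS : A `&` S = A by move=> t; rewrite -{1}AS => -[].
apply: conA; first by exists t0.
- exists (interior [set y | A y -> S y]); first exact: open_interior.
  apply/seteqP; split=> y [Ay Sy]; split=> //; first exact: openS.
  exact: (interior_subset Sy).
- exists (~` interior [set y | A y -> ~ S y]).
    by apply: open_closedC; apply: open_interior.
  apply/seteqP; split=> y [Ay Sy]; split=> //.
    by move=> /interior_subset /(_ Ay).
  by apply: contrapT => nSy; apply: Sy; apply: openNS.
Qed.

Section Identity.
Variable R : realType.
Implicit Types (x y z w : R[i]^o) (e : R[i]).

Definition segment_path (a b : R[i]^o) (t : R) : R[i]^o := a + t%:C * (b - a).

Lemma real_complex_continuous : continuous (fun t : R => t%:C : R[i]^o).
Proof.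
move=> t; apply/cvgrPdist_lt => e e0; near=> s.
rewrite -rmorphB normc_def /= expr0n addr0 sqrtr_sqr.
rewrite -[e]RRe_real ?realE ?(ltW e0) // ltcR.
near: s; apply/nbhs_ballP; exists (complex.Re e); last by move=> y.
by move: e0; rewrite ltcE => /andP[].
Unshelve. all: by end_near. Qed.

Lemma segment_path_continuous a b : continuous (segment_path a b).
Proof.
move=> t; apply: cvgD; first exact: cvg_cst.
apply: cvgM; last exact: cvg_cst.
exact: real_complex_continuous.
Qed.

Lemma cvg_horner (V : Type) (F : set_system V) (FF : Filter F) (p : {poly R[i]})
    (f : V -> R[i]^o) (l : R[i]^o) :
  f @ F --> l -> (fun v => p.[f v] : R[i]^o) @ F --> (p.[l] : R[i]^o).
Proof.
move=> cf; elim/poly_ind: p => [|p c IHp].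
  rewrite horner0 (_ : (fun v => 0.[f v]) = cst 0); first exact: cvg_cst.
  by apply/funext => v; rewrite horner0.
rewrite hornerMXaddC (_ : (fun v => (p * 'X + c%:P).[f v]) = (fun v => p.[f v] * f v + c)).
  exact: (@cvgD _ _ _ F FF _ _ _ _ (@cvgM _ _ F FF _ _ _ _ IHp cf) (@cvg_cst _ _ _ F FF)).
by apply/funext => v; rewrite hornerMXaddC.
Qed.

Lemma cvg_horner2 (V : Type) (F : set_system V) (FF : Filter F) (P : {poly {poly R[i]}})
    (f g : V -> R[i]^o) (l z : R[i]^o) :
  f @ F --> l -> g @ F --> z ->
  (fun v => P.[(f v)%:P].[g v] : R[i]^o) @ F --> (P.[l%:P].[z] : R[i]^o).
Proof.
move=> cf cg; elim/poly_ind: P => [|P c IHP].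
  rewrite !horner0 (_ : (fun v => 0.[(f v)%:P].[g v]) = cst 0); first exact: cvg_cst.
  by apply/funext => v; rewrite !horner0.
rewrite (_ : (fun v => (P * 'X + c%:P).[(f v)%:P].[g v]) = (fun v => P.[(f v)%:P].[g v] * f v + c.[g v])).
  rewrite hornerMXaddC hornerD hornerM hornerC.
  exact: (@cvgD _ _ _ F FF _ _ _ _ (@cvgM _ _ F FF _ _ _ _ IHP cf) (cvg_horner FF cg)).
by apply/funext => v; rewrite hornerMXaddC hornerD hornerM hornerC.
Qed.

Lemma cvg_poly (p : {poly R[i]}) z : (fun y => p.[y] : R[i]^o) @ z --> (p.[z] : R[i]^o).
Proof. exact: (@cvg_horner _ (nbhs z) (nbhs_filter z) p id z (@cvg_id _ (nbhs z))). Qed.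

Lemma near_neq0 (f : R[i]^o -> R[i]^o) z : f @ z --> f z -> f z != 0 ->
  \forall y \near z, f y != 0.
Proof.
move=> cf fz; apply: (cf [set y | y != 0]); apply/nbhs_ballP.
exists `|f z|; first by rewrite /= normr_gt0.
by move=> y; rewrite -ball_normE /=; apply: contraTneq => ->; rewrite subr0 ltxx.
Qed.

Lemma near_nonroot (E : {poly R[i]}) z : E != 0 ->
  \forall y \near z, y != z -> E.[y] != 0.
Proof.
move=> E0; have [m [q]] := multiplicity_XsubC E z; rewrite E0 /= => qz ->.
have : \forall y \near z, q.[y] != 0 by apply: near_neq0 => //; apply: cvg_poly.
apply: filterS => y qy yz; rewrite hornerM horner_exp hornerXsubC mulf_neq0 //.
by rewrite expf_neq0 // subr_eq0.
Qed.

(** * Spreading the zeros of one factor of a vanishing product *)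

Section ZeroProduct.
Variables (U : set R[i]^o) (phi psi : R[i]^o -> R[i]^o) (E : {poly R[i]}).
Hypothesis cphi : forall z, U z -> phi @ z --> phi z.
Hypothesis cpsi : forall z, U z -> psi @ z --> psi z.
Hypothesis phipsi : forall z, U z -> phi z * psi z = 0.
Hypothesis no_common_zero : forall z, U z -> E.[z] != 0 -> phi z = 0 -> psi z != 0.

(** Where [E] is nonzero exactly one of [phi] and [psi] vanishes, so by continuity the zero set of
    [phi] is open and closed along the segment. *)
Lemma zero_along_segment a b :
    (forall t, 0 <= t <= 1 -> U (segment_path a b t) /\ E.[segment_path a b t] != 0) ->
  phi a = 0 -> phi b = 0.
Proof.
move=> seg phia; pose S t := phi (segment_path a b t) = 0.
have segI (t : R) : `[0, 1]%classic t -> U (segment_path a b t) /\ E.[segment_path a b t] != 0.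
  by rewrite /= in_itv /=; apply: seg.
have S0 : S 0 by rewrite /S /segment_path mul0r addr0.
suff : S 1 by rewrite /S /segment_path mul1r addrC subrK.
apply: (@connected_local _ (`[0, 1]%classic : set R) S _ _ _ (0 : R)) => //;
  rewrite ?/= ?in_itv /= ?lexx ?ler01 //.
- exact: segment_connected.
- move=> t /segI[Ut Et] St; have psit := no_common_zero Ut Et St.
  have psi_near : \forall y \near t, psi (segment_path a b y) != 0.
    exact: (@segment_path_continuous a b t _ (near_neq0 (cpsi Ut) psit)).
  apply: filterS psi_near => y psiy /segI[Uy _]; move: (phipsi Uy) => /eqP.
  by rewrite mulf_eq0 (negPf psiy) orbF => /eqP.
- move=> t /segI[Ut Et] /eqP St.
  have phi_near : \forall y \near t, phi (segment_path a b y) != 0.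
    exact: (@segment_path_continuous a b t _ (near_neq0 (cphi Ut) St)).
  by apply: filterS phi_near => y /eqP.
Qed.

(** Two points of a punctured disc are joined by at most two segments that avoid the centre. *)
Lemma zero_in_punctured_disc z e x y :
    (forall w, `|w - z| < e -> U w) -> (forall w, `|w - z| < e -> w != z -> E.[w] != 0) ->
    `|x - z| < e -> x != z -> `|y - z| < e -> y != z ->
  phi x = 0 -> phi y = 0.
Proof.
move=> discU discE.
(* The segment from [w1] to [w2] meets 0 only if [w2] is a nonpositive real multiple of [w1]. *)
have step (w1 w2 : R[i]) : w1 != 0 -> ~ (exists2 r : R, 0 <= r & w2 = - (r%:C * w1)) ->
    `|w1| < e -> `|w2| < e -> phi (z + w1) = 0 -> phi (z + w2) = 0.
  move=> w10 ratio w1e w2e; apply: zero_along_segment => t /andP[t0 t1].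
  have tC0 : 0 <= t%:C :> R[i] by rewrite ler0c.
  have t1C0 : 0 <= (1 - t)%:C :> R[i] by rewrite ler0c subr_ge0.
  have -> : segment_path (z + w1) (z + w2) t = z + ((1 - t)%:C * w1 + t%:C * w2).
    by rewrite /segment_path rmorphB rmorph1; ring.
  set w := (_ * w1 + _).
  have we : `|z + w - z| < e.
    rewrite addrC addKr; apply: le_lt_trans (ler_normD _ _) _.
    rewrite !normrM (ger0_norm tC0) (ger0_norm t1C0).
    have abE : (1 - t)%:C + t%:C = 1 :> R[i] by rewrite -rmorphD subrK.
    have [b0|b0] := eqVneq (t%:C : R[i]) 0.
      by move: abE; rewrite b0 addr0 mul0r addr0 => ->; rewrite mul1r.
    rewrite -[e]mul1r -abE mulrDl; apply: ler_ltD; first by rewrite ler_wpM2l // ltW.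
    by rewrite ltr_pM2l // lt_def b0.
  split; first exact: discU.
  apply: discE => //; apply/eqP => /eqP; rewrite -subr_eq0 addrC addKr => /eqP w0.
  have [tE|t_neq0] := eqVneq t 0.
    by move: w0; rewrite /w tE subr0 mul1r mul0r addr0 => /eqP; rewrite (negPf w10).
  apply: ratio; exists ((1 - t) / t); first by rewrite divr_ge0 // subr_ge0.
  have tC_neq0 : t%:C != 0 :> R[i] by rewrite (fmorph_eq0 (real_complex R)).
  apply: (mulfI tC_neq0); move: w0 => /eqP; rewrite /w addrC addr_eq0 => /eqP ->.
  by rewrite rmorphM fmorphV; field.
move=> xe xz ye yz phix; pose w1 : R[i] := x - z; pose w2 : R[i] := y - z.
have w10 : w1 != 0 by rewrite subr_eq0.
have xE : z + w1 = x by rewrite /w1 addrC subrK.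
have yE : z + w2 = y by rewrite /w2 addrC subrK.
have iw1 : `|'i%C * w1| = `|w1|.
  by rewrite normrM [`|'i%C|]normc_def /= expr0n expr1n add0r sqrtr1 mul1r.
have [[r r0 w2E]|nr] := pselect (exists2 r : R, 0 <= r & w2 = - (r%:C * w1)); last first.
  by rewrite -yE; apply: (step w1) => //; rewrite xE.
(* The segment from [x] to [y] goes through [z]: go around it via [z + i (x - z)]. *)
rewrite -yE; apply: (step ('i%C * w1)); rewrite ?iw1 //.
- by rewrite mulf_neq0 // eq_complex /= oner_eq0 andbF.
- move=> [r' _]; rewrite w2E => /oppr_inj; rewrite mulrA => /(mulIf w10) /eqP.
  rewrite eq_complex /= => /andP[/eqP rE _]; have {}rE : r = 0 by rewrite rE; ring.
  by case/eqP: yz; rewrite -yE w2E rE mul0r oppr0 addr0.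
- apply: (step w1); rewrite ?iw1 ?xE // => -[r' _ /eqP].
  rewrite -mulNr => /eqP /(mulIf w10) /eqP.
  by rewrite eq_complex /= oppr0 oner_eq0 andbF.
Qed.

(** The zeros of [E] are isolated, and around each point of [U] the function [phi] vanishes either
    everywhere or nowhere on a small punctured disc. Connectedness of [U] does the rest. *)
Lemma zero_product_identity z0 : open U -> connected U -> E != 0 -> U z0 -> E.[z0] != 0 ->
  phi z0 = 0 -> forall z, U z -> phi z = 0.
Proof.
move=> oU cU E0 Uz0 Ez0 phi0 z Uz.
(* Vanishing in a neighbourhood rather than at the point: at a zero of [E] both factors may vanish,
   and a single zero of [phi] need not spread. *)
pose S (w : R[i]^o) := \forall y \near w, phi y = 0.
suff : S z by apply: nbhs_singleton.
apply: (@connected_local _ U S cU _ _ z0) => //.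
- by move=> w Uw Sw; have := nbhs_interior Sw; apply: filterS.
- move=> w Uw nSw.
  have nU : nbhs w U by apply: open_nbhs_nbhs.
  have : nbhs w (U `&` [set y | y != w -> E.[y] != 0]).
    by apply: filterI => //; apply: near_nonroot.
  move=> /nbhs_ballP[e /= e0 ballUE].
  have discUE v : `|v - w| < e -> U v /\ (v != w -> E.[v] != 0).
    by move=> vw; apply: ballUE; rewrite -ball_normE /= distrC.
  have punctured y : `|y - w| < e -> y != w -> phi y != 0.
    move=> ye yw; apply/eqP => phiy; apply: nSw.
    have phiv v : `|v - w| < e -> v != w -> phi v = 0.
      move=> ve vw; apply: (@zero_in_punctured_disc w e y v) => //.
        by move=> u /discUE[].
      by move=> u /discUE[].
    have phiw : phi w = 0.
      apply: contrapT => /eqP /(near_neq0 (cphi Uw)) phinear.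
      have near_e : \forall y \near w, `|y - w| < e.
        by apply/nbhs_ballP; exists e => //= v; rewrite -ball_normE /= distrC.
      have : nbhs w ([set y | phi y != 0] `&` [set y | `|y - w| < e]) by apply: filterI.
      move=> /nbhs_ballP[e' /= e'0 sub].
      (* [w + e' / 2] lies in the punctured disc, where [phi] would be both zero and nonzero. *)
      have h0 : 0 < e' / 2 by rewrite divr_gt0.
      have [|/eqP phih he] := sub (w + e' / 2).
        rewrite -ball_normE /= opprD addrA subrr add0r normrN gtr0_norm //.
        by rewrite ltr_pdivrMr // mulr_natr mulr2n ltrDl.
      apply: phih; apply: phiv => //.
      by rewrite -subr_eq0 addrC addKr gt_eqF.
    apply/nbhs_ballP; exists e => //= v; rewrite -ball_normE /= distrC => ve.
    by have [->|] := eqVneq v w; last exact: phiv.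
  apply/nbhs_ballP; exists e; first exact: e0.
  move=> y; rewrite -ball_normE => wye _ Sy.
  have ye : `|y - w| < e by rewrite distrC.
  have [yw|yw] := eqVneq y w; first by apply: nSw; rewrite -yw.
  by have /eqP := punctured y ye yw; apply; apply: nbhs_singleton Sy.
have nU : nbhs z0 U by apply: open_nbhs_nbhs.
apply: filterS (filterI nU (near_neq0 (cpsi Uz0) (no_common_zero Uz0 Ez0 phi0))) => y [Uy psiy].
by have /eqP := phipsi Uy; rewrite mulf_eq0 (negPf psiy) orbF => /eqP.
Qed.

End ZeroProduct.

End Identity.

(** * From the expansion back to the function on its domain *)

Lemma complex_archi (R : realType) (x : R[i]) : exists n : nat, `|x| <= n%:R.
Proof.
exists (Num.bound (complex.Re `|x|)); have nx : `|x| \is Num.real by apply: normr_real.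
rewrite -(RRe_real nx) -(rmorph_nat (real_complex R)) lecR ltW //.
by apply: le_lt_trans (archi_boundP _); rewrite ?ler_norm // -ler0c RRe_real.
Qed.

Lemma analytic_on_cvg (R : realType) (U : set R[i]^o) (f : R[i]^o -> R[i]^o) z :
  analytic_on U f -> U z -> f @ z --> f z.
Proof. by move=> hf Uz; apply/differentiable_continuous/derivable1_diffP/hf. Qed.

(** Pseudo-division by the linear polynomial [L] leaves a remainder free of [w], which vanishes
    wherever [q] and [s] do not, hence is 0. The multiplier [c] is a power of [q]. *)
Lemma rational_root_factor (C : numClosedFieldType) (P : {poly {poly C}}) (p q s : {poly C}) :
    q != 0 -> s != 0 -> (forall z, s.[z] != 0 -> P.[(p.[z] / q.[z])%:P].[z] = 0) ->
  exists c A, (forall z, q.[z] != 0 -> c.[z] != 0) /\ c *: P = A * (q *: 'X - p%:P).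
Proof.
move=> q0 s0 Ppq; set L := q *: 'X - p%:P.
have LE : L = \poly_(i < 2) (if i == 0%N then - p else q).
  by rewrite poly_def !big_ord_recl big_ord0 /= expr0 expr1 addr0 alg_polyC polyCN addrC.
have szL : size L = 2%N by rewrite LE size_poly_eq.
have lcL : lead_coef L = q by rewrite lead_coefE szL LE coef_poly.
have := Pdiv.Idomain.divp_eq P L; set A := _ %/ _; set r := _ %% _; set k := scalp _ _ => PE.
have /size1_polyC rE : (size r <= 1)%N by rewrite -ltnS -szL Pdiv.Idomain.ltn_modp -size_poly_gt0 szL.
exists (q ^+ k), A; split=> [z qz|]; first by rewrite horner_exp expf_neq0.
rewrite -lcL PE; suff -> : r = 0 by rewrite addr0.
set r0 := r`_0 in rE.
have [/eqP|] := eqVneq (r0 * (q * s)) 0.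
  by rewrite !mulf_eq0 (negPf q0) (negPf s0) !orbF => /eqP r00; rewrite rE r00.
move=> /poly_nat_nonroot[n /(_ n (leqnn n))].
rewrite !hornerM !mulf_eq0 !negb_or => /and3P[r0n qn sn].
case/eqP: r0n; have /(congr1 (fun Q : {poly {poly C}} => Q.[(p.[n%:R] / q.[n%:R])%:P].[n%:R])) := PE.
rewrite hornerZ hornerM Ppq // mulr0 hornerD hornerM hornerD hornerM rE hornerC.
rewrite /L hornerD hornerN hornerC hornerZ hornerX hornerD hornerN hornerM hornerC.
by rewrite mulrCA divff // mulr1 subrr mulr0 add0r => <-.
Qed.

Theorem theorem12 (R : realType) (U : set R[i]^o) (f : R[i]^o -> R[i]^o)
  (hUopen : open U) (hUconn : connected U)
  (hU1 : forall x : R, 1 <= x -> U x%:C)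
  (hfan : analytic_on U f) (hfalg : algebraic_on U f) :
  holonomic (fun n : nat => f n%:R) <-> rational_on U f.
Proof.
have Un n : (1 <= n)%N -> U n%:R.
  by move=> n1; rewrite -(rmorph_nat (real_complex R)); apply: hU1; rewrite ler1n.
split; last first.
  move=> [p [q [q0 fE]]]; apply: (@rational_holonomic _ _ p q) => // n n1.
  exact: fE (Un n n1).
move=> [d [p [pk rec]]]; have [P0 [P00 P0f]] := hfalg.
have [d' [p' [N [p'0 rec']]]] := holonomic_normal (a := fun n => f n%:R) pk rec.
have [P [D0 [P_neq0 D0_neq0 [V [W VWD]] annP]]] := separable_annihilator P00.
have Pf z : U z -> P.[(f z)%:P].[z] = 0 by move=> /P0f; apply: annP.
have [||p1 [q1 [n [le_n D0n q1n q1a P1]]]] :=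
  @holonomic_algebraic_rational _ (@complex_archi R) P D0 (fun n => f n%:R) d' p' (maxn N 1)
    P_neq0 D0_neq0 (ex_intro _ V (ex_intro _ W VWD)) _ p'0.
- by move=> n; rewrite geq_max => /andP[_ /Un]; apply: Pf.
- by move=> n; rewrite geq_max => /andP[/rec'].
have Uz0 : U n%:R by apply: Un; apply: leq_trans le_n; rewrite leq_maxr.
have q10 : q1 != 0 by apply: contraNneq q1n => ->; rewrite horner0.
(* In lowest terms a zero of the denominator in [U] can be excluded: the identity [q2 f = p2] would
   make it a common root. *)
pose g := gcdp p1 q1; pose p2 := p1 %/ g; pose q2 := q1 %/ g.
have p1E : p1 = p2 * g by rewrite divpK // dvdp_gcdl.
have q1E : q1 = q2 * g by rewrite divpK // dvdp_gcdr.
have co : coprimep p2 q2 by apply: coprimep_div_gcd; rewrite q10 orbT.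
have q20 : q2 != 0 by apply: contraNneq q10 => q20; rewrite q1E q20 mul0r.
clearbody p2 q2.
have P2 z : q1.[z] != 0 -> P.[(p2.[z] / q2.[z])%:P].[z] = 0.
  move=> q1z; have := P1 z q1z; move: q1z; rewrite p1E q1E !hornerM mulf_eq0 negb_or => /andP[q2z gz].
  by rewrite -mulf_div divff // mulr1.
have [c [A [c0 PE]]] := rational_root_factor q20 q10 P2.
have [q2n gn] : q2.[n%:R] != 0 /\ g.[n%:R] != 0.
  by move: q1n; rewrite q1E hornerM mulf_eq0 negb_or => /andP.
have q2a : q2.[n%:R] * f n%:R = p2.[n%:R].
  apply: (mulIf gn); rewrite -hornerM -p1E -q1a q1E hornerM; ring.
(* [phi] and [psi] are the two factors of [c P] at [w = f z]; [phi] vanishes at [n] and has to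
   vanish on all of [U]. *)
pose phi (z : R[i]^o) : R[i]^o := q2.[z] * f z - p2.[z].
pose psi (z : R[i]^o) : R[i]^o := A.[(f z)%:P].[z].
have LE z : (q2 *: 'X - p2%:P).[(f z)%:P].[z] = phi z.
  by rewrite !(hornerD, hornerN, hornerZ, hornerX, hornerC, hornerM).
have cf z : U z -> f @ z --> f z by apply: analytic_on_cvg.
have cphi z : U z -> phi @ z --> phi z.
  move=> Uz; have cqf := @cvgM _ _ (nbhs z) (nbhs_filter z) _ _ _ _ (@cvg_poly R q2 z) (cf z Uz).
  exact: (@cvgB _ _ _ (nbhs z) (nbhs_filter z) _ _ _ _ cqf (@cvg_poly R p2 z)).
have cpsi z : U z -> psi @ z --> psi z.
  move=> Uz; exact: (@cvg_horner2 _ _ (nbhs z) (nbhs_filter z) A f id _ z (cf z Uz) (@cvg_id _ (nbhs z))).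
have phipsi z : U z -> phi z * psi z = 0.
  move=> Uz; rewrite mulrC -LE -!hornerM -PE hornerZ hornerM Pf //; exact: mulr0.
(* At a common zero the derivative of the factorization makes [f z] a multiple root of [P], which
   the Bezout relation allows only at zeros of [D0]. *)
have no_common_zero z : U z -> (q2 * D0).[z] != 0 -> phi z = 0 -> psi z != 0.
  move=> Uz; rewrite hornerM mulf_eq0 negb_or => /andP[q2z D0z] phiz.
  apply: contraNneq D0z => psiz.
  have /(congr1 (fun Q : {poly {poly R[i]}} => Q^`().[(f z)%:P].[z])) := PE.
  rewrite derivZ derivM hornerZ hornerM !hornerD !hornerM LE phiz mulr0 add0r.
  rewrite -[A.[_].[_]]/(psi z) psiz mul0r => /eqP; rewrite mulf_eq0 (negPf (c0 z q2z)) /= => /eqP dPz.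
  have /(congr1 (fun Q : {poly {poly R[i]}} => Q.[(f z)%:P].[z])) := VWD.
  by rewrite hornerD !hornerM hornerD !hornerM Pf // dPz !mulr0 addr0 hornerC => <-.
have E0 : q2 * D0 != 0 by rewrite mulf_neq0.
have En : (q2 * D0).[n%:R] != 0 by rewrite hornerM mulf_neq0.
have phin : phi n%:R = 0 by rewrite /phi q2a subrr.
have phi0 := @zero_product_identity R U phi psi (q2 * D0) cphi cpsi phipsi
  no_common_zero n%:R hUopen hUconn E0 Uz0 En phin.
have q2f z : U z -> q2.[z] * f z = p2.[z].
  by move=> /phi0/eqP; rewrite subr_eq0 => /eqP.
exists p2, q2; split=> // z Uz.
have q2z : q2.[z] != 0.
  apply/eqP => q2z; have := q2f z Uz; rewrite q2z mul0r => /esym p2z.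
  have rp2 : root p2 z by rewrite /root p2z.
  by have := coprimep_root co rp2; rewrite q2z eqxx.
by split=> //; rewrite -q2f // mulrC mulKf.
Qed.
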